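(* Let $R$ be a ring, let $\mathfrak{X}$ be a class of left $R$-modules that contains all projective left $R$-modules, and let $n$ be a non-negative integer. The following statements are equivalent: (1) $l.\mathfrak{X}\text{-}\mathrm{Ggldim}(R)\leq n$. (2) $\mathfrak{X}\text{-}\mathrm{Gpd}(M)\leq n$ for every finitely generated left $R$-module $M$. (3) $\mathfrak{X}\text{-}\mathrm{Gpd}(R/I)\leq n$ for every left ideal $I$ of $R$. Consequently, $$l.\mathfrak{X}\text{-}\mathrm{Ggldim}(R)=\sup\{\mathfrak{X}\text{-}\mathrm{Gpd}(M)\mid M \text{ is a finitely generated left } R\text{-module}\}=\sup\{\mathfrak{X}\text{-}\mathrm{Gpd}(R/I)\mid I \text{ is a left ideal of } R\}.$$
   Context: $R$ is a non-trivial associative ring with identity; all modules are unital left $R$-modules. A module $G$ is called $\mathfrak{X}$-Gorenstein projective if there is an exact sequence $\cdots\to P_1\to P_0\to P^0\to P^1\to\cdots$ of projective modules which remains exact after applying $\mathrm{Hom}_R(-,X)$ for every $X\in\mathfrak{X}$, and such that $G=\mathrm{Ker}(P_0\to P^0)$ (up to isomorphism). For a module $M$, $\mathfrak{X}\text{-}\mathrm{Gpd}(M)$ is the infimum of all integers $n\ge 0$ for which there is an exact sequence $0\to G_n\to\cdots\to G_1\to G_0\to M\to 0$ with all $G_i$ $\mathfrak{X}$-Gorenstein projective, and $\mathfrak{X}\text{-}\mathrm{Gpd}(M)=\infty$ if there is no such $n$. The left $\mathfrak{X}$-Gorenstein global projective dimension is $l.\mathfrak{X}\text{-}\mathrm{Ggldim}(R)=\sup\{\mathfrak{X}\text{-}\mathrm{Gpd}(M)\mid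 M \text{ any left } R\text{-module}\}$. *)

(* Defs.v *)
From HB Require Import structures.
From mathcomp Require Import all_boot all_order all_algebra.
From mathcomp Require Import boolp classical_sets reals ereal.

Set Implicit Arguments.
Unset Strict Implicit.
Unset Printing Implicit Defensive.

Import Order.TTheory GRing.Theory Num.Theory.

Local Open Scope ring_scope.

(* As [R] is not assumed commutative, [lmodType R] is the type of unital left
   R-modules and [submodClosed R^o] the type of left ideals of [R].  The latter
   are boolean predicates, which classically is no restriction. *)

Section LeftQuotient.
Variables (R : nzRingType) (V : lmodType R) (I : submodClosed V).

Definition submod_pred : V -> bool := fun x => x \in I.

Lemma submod_pred_closed : zmod_closed submod_pred.
Proof. exact: (GRing.submod_closedB (submodClosedP I)). Qed.

HB.instance Definition _ := GRing.isZmodClosed.Build V submod_pred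
  submod_pred_closed.

Definition submod_zmodClosed : zmodClosed V :=
  GRing.ZmodClosed.clone V submod_pred _.

(* The library only gives [Quotient.quot] an additive group structure (and a
   ring structure in the commutative case); the R-action is added here. *)
Definition quot_mod := Quotient.quot submod_zmodClosed.

HB.instance Definition _ := GRing.Zmodule.on quot_mod.

Definition quot_proj (x : V) : quot_mod := (\pi_(Quotient.quot submod_zmodClosed) x)%qT.

Lemma quot_projP x y : (quot_proj x = quot_proj y) <-> (x - y \in I).
Proof.
rewrite /quot_proj; split=> [/eqP|xy].
  by rewrite -(Quotient.idealrBE submod_zmodClosed).
by apply/eqP; rewrite -(Quotient.idealrBE submod_zmodClosed).
Qed.

Lemma quot_proj_is_additive : zmod_morphism quot_proj.
Proof. by move=> x y; rewrite /quot_proj raddfB. Qed.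

Lemma quot_projD x y : quot_proj (x + y) = quot_proj x + quot_proj y.
Proof. by rewrite /quot_proj raddfD. Qed.

Definition quot_repr (q : quot_mod) : V :=
  repr (q : Quotient.quot submod_zmodClosed).

Lemma quot_reprK q : quot_proj (quot_repr q) = q.
Proof. exact: reprK. Qed.

Definition quot_scale (a : R) (q : quot_mod) : quot_mod :=
  quot_proj (a *: quot_repr q).

Lemma quot_scaleE a x : quot_scale a (quot_proj x) = quot_proj (a *: x).
Proof.
apply/quot_projP; rewrite -scalerBr; apply: rpredZ.
by apply/quot_projP; rewrite quot_reprK.
Qed.

Fact quot_scaleA a b q : quot_scale a (quot_scale b q) = quot_scale (a * b) q.
Proof. by rewrite -[q]quot_reprK !quot_scaleE scalerA. Qed.

Fact quot_scale1 : left_id 1 quot_scale.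
Proof. by move=> q; rewrite -[q]quot_reprK quot_scaleE scale1r. Qed.

Fact quot_scaleDr : right_distributive quot_scale +%R.
Proof.
move=> a p q; rewrite -[p]quot_reprK -[q]quot_reprK -quot_projD !quot_scaleE.
by rewrite scalerDr quot_projD.
Qed.

Fact quot_scaleDl q : {morph quot_scale^~ q : a b / a + b}.
Proof.
by move=> a b; rewrite -[q]quot_reprK !quot_scaleE scalerDl quot_projD.
Qed.

HB.instance Definition _ := GRing.Zmodule_isLmodule.Build R quot_mod
  quot_scaleA quot_scale1 quot_scaleDr quot_scaleDl.

Fact quot_proj_is_scalable : scalable quot_proj.
Proof. by move=> a x; rewrite -quot_scaleE. Qed.

HB.instance Definition _ := GRing.isZmodMorphism.Build V quot_mod quot_proj
  quot_proj_is_additive.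
HB.instance Definition _ := GRing.isScalable.Build R V quot_mod *:%R quot_proj
  quot_proj_is_scalable.

End LeftQuotient.

Section Modules.
Variable R : nzRingType.

Definition finitely_generated (M : lmodType R) : Prop :=
  exists (k : nat) (g : 'I_k -> M),
    forall m : M, exists c : 'I_k -> R, m = \sum_(i < k) c i *: g i.

Definition surj (A B : lmodType R) (f : {linear A -> B}) : Prop :=
  forall b : B, exists a : A, f a = b.

Definition projective (P : lmodType R) : Prop :=
  forall (A B : lmodType R) (f : {linear A -> B}) (g : {linear P -> B}),
    surj f -> exists h : {linear P -> A}, forall x : P, f (h x) = g x.

Definition exact_at (A B C : lmodType R)
    (f : {linear A -> B}) (g : {linear B -> C}) : Prop :=
  forall b : B, g b = 0 <-> exists a : A, f a = b.

(* Exactness at Hom(B, X) of Hom(C, X) -> Hom(B, X) -> Hom(A, X), the image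
   under Hom_R(-, X) of A -f-> B -g-> C. *)
Definition Hom_exact_at (X A B C : lmodType R)
    (f : {linear A -> B}) (g : {linear B -> C}) : Prop :=
  forall h : {linear B -> X},
    (forall a : A, h (f a) = 0) <->
    exists k : {linear C -> X}, forall b : B, k (g b) = h b.

(* ... -> lo 1 -> lo 0 -> hi 0 -> hi 1 -> ...  with lo i = P_i, hi i = P^i. *)
Record biseq := BiSeq {
  lo : nat -> lmodType R;
  hi : nat -> lmodType R;
  dlo : forall i : nat, {linear lo i.+1 -> lo i};
  dmid : {linear lo 0%N -> hi 0%N};
  dhi : forall i : nat, {linear hi i -> hi i.+1}
}.

Definition at_every_term
    (E : forall A B C : lmodType R,
       {linear A -> B} -> {linear B -> C} -> Prop) (S : biseq) : Prop :=
  [/\ forall i : nat, E _ _ _ (dlo S i.+1) (dlo S i),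
      E _ _ _ (dlo S 0%N) (dmid S),
      E _ _ _ (dmid S) (dhi S 0%N) &
      forall i : nat, E _ _ _ (dhi S i) (dhi S i.+1)].

(* The last clause says that [iota] is an isomorphism of [G] onto
   Ker(P_0 -> P^0). *)
Definition Gorenstein_projective (XX : lmodType R -> Prop) (G : lmodType R) :
    Prop :=
  exists S : biseq,
    [/\ forall i : nat, projective (lo S i) /\ projective (hi S i),
        at_every_term exact_at S,
        forall X : lmodType R, XX X -> at_every_term (Hom_exact_at X) S &
        exists iota : {linear G -> lo S 0%N},
          injective iota /\
          forall x : lo S 0%N, dmid S x = 0 <-> exists g : G, iota g = x].

(* 0 -> G_n -> ... -> G_0 -> M -> 0 is encoded as an exact sequence
   ... -> G_1 -> G_0 -> M -> 0 in which G_i = 0 for i > n. *)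
Definition Gorenstein_resolution (XX : lmodType R -> Prop) (n : nat)
    (M : lmodType R) : Prop :=
  exists (G : nat -> lmodType R) (d : forall i : nat, {linear G i.+1 -> G i})
         (e : {linear G 0%N -> M}),
    [/\ forall i : nat, (i <= n)%N -> Gorenstein_projective XX (G i),
        forall i : nat, (n < i)%N -> forall x : G i, x = 0,
        surj e,
        exact_at (d 0%N) e &
        forall i : nat, exact_at (d i.+1) (d i)].

End Modules.

Section Dimensions.
Local Open Scope classical_set_scope.
Local Open Scope ereal_scope.

(* Dimensions take values in the extended reals over an arbitrary [K]; the
   infimum of the empty set is [+oo]. *)
Variables (K : realType) (R : nzRingType) (XX : lmodType R -> Prop).

Definition Gpd (M : lmodType R) : \bar K :=
  ereal_inf [set d | exists2 n : nat,
                       Gorenstein_resolution XX n M & d = n%:R%:E].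

Definition Ggldim : \bar K :=
  ereal_sup [set d | exists M : lmodType R, d = Gpd M].

End Dimensions.

(* Main.v *)
Require Import Defs.
From HB Require Import structures.
From mathcomp Require Import all_boot all_order all_algebra.
From mathcomp Require Import boolp wochoice classical_sets reals ereal.

Set Implicit Arguments.
Unset Strict Implicit.
Unset Printing Implicit Defensive.

Import Order.TTheory GRing.Theory Num.Theory.

Local Open Scope ring_scope.

(** Everything rests on one closure property: a module with a well-ordered
    filtration whose factors (each stage modulo the union of the earlier ones)
    are XX-Gorenstein projective is itself XX-Gorenstein projective
    ([Gorenstein_filtered]). It holds because the class of such filtered
    modules has the three properties that yield complete resolutions:
    - the filtered horseshoe lemma ([filtered_syzygy]): surjections from
      projectives onto the factors add up to a surjection from the direct sum
      of these projectives, and its kernel is filtered by their kernels;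
    - its dual ([filtered_cosyzygy]): embeddings of the factors into
      projectives are assembled, by recursion along the filtration, into an
      embedding in the direct sum of these projectives, whose cokernel is
      filtered by the cokernels of the embeddings; each step of the recursion
      extends a map with projective values over one more factor, which is
      possible because projectives belong to XX and Ext^1(G, X) = 0 for every
      XX-Gorenstein projective G and every X in XX;
    - the lemma of Eklof ([eklof]): Ext^1(-, X) = 0 passes from the factors to
      the filtered module, so that the exact sequences just obtained remain
      exact under Hom(-, X) for every X in XX.
    The syzygies and cosyzygies of a filtered module being filtered again, both
    constructions can be iterated, and the resulting short exact sequences are
    spliced into a complete resolution ([Gorenstein_of_class]).

    Let P_0 be the class of XX-Gorenstein projectives, and P_(n+1) the class of
    the quotients of projectives by submodules in P_n, written
    [iter n syzygy]. By the filtered horseshoe lemma each P_n is closed under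
    filtrations ([iter_syzygy_filtered]), in particular under extensions, and
    extension closure turns a resolution by XX-Gorenstein projectives of length
    n into membership in P_n; hence Gpd M <= n exactly when M lies in P_n
    ([Gpd_le_syzygies]). Finally, well-ordering the elements of an arbitrary
    module M filters it with cyclic factors R/I ([filtered_cyclic]). So if all
    R/I lie in P_n, then so does M: a bound for the cyclic modules is a bound
    for all modules. The bound for finitely generated modules lies in between,
    since R/I is finitely generated.

    The equalities of suprema follow since a dimension is a natural number or
    +oo, and so is a supremum of dimensions ([sup_natural]): two such values
    are compared by comparing their natural upper bounds. *)

(** * Submodules given by predicates *)

Section Submodules.
Variables (R : nzRingType).
Implicit Types V X A B C : lmodType R.

Record submodule V := Submodule {
  carrier :> V -> Prop;
  carrier0 : carrier 0;
  carrier_lin : forall a x y, carrier x -> carrier y -> carrier (a *: x + y)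
}.

Lemma carrierD V (S : submodule V) x y : S x -> S y -> S (x + y).
Proof. by rewrite -{2}[x]scale1r; apply: carrier_lin. Qed.

Lemma carrierZ V (S : submodule V) a x : S x -> S (a *: x).
Proof.
by move=> Sx; rewrite -[_ *: _]addr0; apply: carrier_lin (carrier0 S).
Qed.

Lemma carrierN V (S : submodule V) x : S x -> S (- x).
Proof. by rewrite -scaleN1r; apply: carrierZ. Qed.

Lemma carrierB V (S : submodule V) x y : S x -> S y -> S (x - y).
Proof. by move=> Sx Sy; apply: carrierD (carrierN Sy). Qed.

Lemma carrier_sum V (S : submodule V) I (r : seq I) (P : pred I) (F : I -> V) :
  (forall i, S (F i)) -> S (\sum_(i <- r | P i) F i).
Proof.
by move=> SF; elim/big_rec: _ => [|i x _]; [apply: carrier0|apply: carrierD].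
Qed.

Section SubType.
Variables (V : lmodType R) (S : submodule V).

(** Boolean form of the predicate, as required by the generic construction of
    submodules as subtypes. *)
Definition in_sub : V -> bool := fun x => `[< S x >].

Fact in_sub_closed : submod_closed in_sub.
Proof.
split=> [|a x y /asboolP Sx /asboolP Sy]; apply/asboolP; first exact: carrier0.
exact: carrier_lin.
Qed.

HB.instance Definition _ := GRing.isSubmodClosed.Build R V in_sub
  (GRing.submod_closed_semi in_sub_closed).

Definition sub_mod := {x : V | in_sub x}.
HB.instance Definition _ := [isSub of sub_mod for @sval V in_sub].
HB.instance Definition _ := [Choice of sub_mod by <:].
HB.instance Definition _ := [SubChoice_isSubLmodule of sub_mod by <:].

Definition incl : {linear sub_mod -> V} := \val.

Lemma inclP (x : sub_mod) : S (incl x).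
Proof. by have /asboolP := valP x. Qed.

Lemma incl_inj : injective incl.
Proof. exact: val_inj. Qed.

Definition lift_sub x (Sx : S x) : sub_mod := exist _ x (introT (asboolP _) Sx).

Lemma lift_subK x (Sx : S x) : incl (lift_sub Sx) = x.
Proof. by []. Qed.

End SubType.

(** Linearity on a submodule of a function whose values elsewhere are
    irrelevant. Partial linear maps are represented this way so that maps
    defined on different submodules all have the same type. *)
Definition lin_on V X (S : V -> Prop) (f : V -> X) : Prop :=
  forall a x y, S x -> S y -> f (a *: x + y) = a *: f x + f y.

Lemma linear_of A B (f : A -> B) :
  (forall a x y, f (a *: x + y) = a *: f x + f y) ->
  exists g : {linear A -> B}, g =1 f.
Proof.
move=> flin; have fl : linear f by [].
pose m := GRing.isLinear.Build R A B *:%R f fl.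
pose g : {linear A -> B} := HB.pack f m.
by exists g.
Qed.

(** Linear maps are mostly defined by a property of their values: choice gives
    the function, and its linearity is inherited from that of the property. *)
Lemma linear_choice A B (Q : A -> B -> Prop) :
  (forall x, exists y, Q x y) -> (forall x y y', Q x y -> Q x y' -> y = y') ->
  (forall a x y x' y', Q x x' -> Q y y' -> Q (a *: x + y) (a *: x' + y')) ->
  exists g : {linear A -> B}, forall x, Q x (g x).
Proof.
move=> Qex Quniq Qlin; have [f fP] := choice Qex.
have [|g gE] := @linear_of A B f; last by exists g => x; rewrite gE.
by move=> a x y; apply: Quniq (fP _) (Qlin _ _ _ _ _ (fP _) (fP _)).
Qed.

Lemma lin_on_restrict V X (S : submodule V) (f : V -> X) : lin_on S f ->
  exists g : {linear sub_mod S -> X}, forall x, g x = f (incl S x).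
Proof.
move=> flin; apply: linear_of => a x y.
by rewrite linearP; apply: flin (inclP x) (inclP y).
Qed.

Lemma factor_through_inj A B C (i : {linear B -> C}) (f : {linear A -> C}) :
  injective i -> (forall x, exists y, i y = f x) ->
  exists g : {linear A -> B}, forall x, i (g x) = f x.
Proof.
move=> i_inj fi; apply: (@linear_choice A B (fun x y => i y = f x)) => //.
  by move=> x y y' <- /i_inj.
by move=> a x y x' y' Ex Ey; rewrite !linearP Ex Ey.
Qed.

Lemma factor_through_surj A B C (p : {linear A -> B}) (f : {linear A -> C}) :
  surj p -> (forall x, p x = 0 -> f x = 0) ->
  exists g : {linear B -> C}, forall x, g (p x) = f x.
Proof.
move=> ps pf.
have [|||g gP] := @linear_choice B C (fun y z => exists2 x, p x = y & f x = z).
- by move=> y; have [x xE] := ps y; exists (f x), x.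
- move=> y z z' [x xy xz] [x' xy' xz']; apply/eqP; rewrite -subr_eq0 -xz -xz'.
  by rewrite -linearB pf // linearB xy xy' subrr.
- move=> a x y x' y' [u <- <-] [v <- <-]; exists (a *: u + v); exact: linearP.
exists g => x; have [x' xx' <-] := gP (p x).
by apply/eqP; rewrite -subr_eq0 -linearB pf // linearB xx' subrr.
Qed.

Lemma corestrict A B (S : submodule B) (f : {linear A -> B}) :
  (forall x, S (f x)) ->
  exists g : {linear A -> sub_mod S}, forall x, incl S (g x) = f x.
Proof.
move=> Sf; apply: (factor_through_inj (@incl_inj _ _)) => x.
by exists (lift_sub (Sf x)).
Qed.

Definition zero_sub V : submodule V.
Proof.
by exists (fun x => x = 0) => // a x y -> ->; rewrite scaler0 addr0.
Defined.

Definition full_sub V : submodule V.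
Proof. by exists (fun x => True). Defined.

Definition ker_sub A B (f : {linear A -> B}) : submodule A.
Proof.
exists (fun x => f x = 0); first exact: raddf0.
by move=> a x y fx fy; rewrite linearP fx fy scaler0 addr0.
Defined.

Definition im_sub A B (f : {linear A -> B}) (S : submodule A) : submodule B.
Proof.
exists (fun y => exists2 x, S x & f x = y).
  by exists 0; [exact: carrier0|exact: raddf0].
move=> a x y [u Su <-] [v Sv <-]; exists (a *: u + v); first exact: carrier_lin.
exact: linearP.
Defined.

Definition preim_sub A B (f : {linear A -> B}) (S : submodule B) : submodule A.
Proof.
exists (fun x => S (f x)); first by rewrite raddf0; exact: carrier0.
by move=> a x y Sx Sy; rewrite linearP; exact: carrier_lin.
Defined.

Definition span_sub V (T : V -> Prop) : submodule V.
Proof.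
exists (fun x => forall S : submodule V, (forall v, T v -> S v) -> S x).
  by move=> S _; exact: carrier0.
by move=> a x y Tx Ty S TS; apply: carrier_lin; [exact: Tx|exact: Ty].
Defined.

(** The sum of the image of [c] and of [S]. *)
Definition sum_im_sub A V (c : {linear A -> V}) (S : submodule V) : submodule V.
Proof.
exists (fun x => exists r, S (x - c r)).
  by exists 0; rewrite raddf0 subr0; exact: carrier0.
move=> a y z [r yr] [s zs]; exists (a *: r + s).
by rewrite linearP opprD addrACA -scalerBr; exact: (carrier_lin a yr zs).
Defined.

Definition short_exact A B C (i : {linear A -> B}) (p : {linear B -> C}) :=
  [/\ injective i, exact_at i p & surj p].

Lemma kernel_exact A B (p : {linear A -> B}) :
  surj p -> short_exact (incl (ker_sub p)) p.
Proof.
move=> ps; split=> //; first exact: incl_inj.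
move=> x; split=> [px|[y <-]]; last exact: (inclP y).
by exists (lift_sub (S := ker_sub p) px).
Qed.

End Submodules.

(** * Direct sums and projective modules *)

Section Product.
Variables (R : nzRingType) (W : Type) (Q : W -> lmodType R).

Definition dprod := forall w, Q w.

Lemma dprod_ext (x y : dprod) : (forall w, x w = y w) -> x = y.
Proof. exact: functional_extensionality_dep. Qed.

HB.instance Definition _ := gen_eqMixin dprod.
HB.instance Definition _ := gen_choiceMixin dprod.

Definition dprod_add (x y : dprod) : dprod := fun w => x w + y w.
Definition dprod_opp (x : dprod) : dprod := fun w => - x w.
Definition dprod_scale (a : R) (x : dprod) : dprod := fun w => a *: x w.

Fact dprod_addA : associative dprod_add.
Proof. by move=> x y z; apply: dprod_ext => w; apply: addrA. Qed.
Fact dprod_addC : commutative dprod_add.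
Proof. by move=> x y; apply: dprod_ext => w; apply: addrC. Qed.
Fact dprod_add0 : left_id (fun=> 0) dprod_add.
Proof. by move=> x; apply: dprod_ext => w; apply: add0r. Qed.
Fact dprod_addN : left_inverse (fun=> 0) dprod_opp dprod_add.
Proof. by move=> x; apply: dprod_ext => w; apply: addNr. Qed.

HB.instance Definition _ := GRing.isZmodule.Build dprod
  dprod_addA dprod_addC dprod_add0 dprod_addN.

Fact dprod_scaleA a b x :
  dprod_scale a (dprod_scale b x) = dprod_scale (a * b) x.
Proof. by apply: dprod_ext => w; apply: scalerA. Qed.
Fact dprod_scale1 : left_id 1 dprod_scale.
Proof. by move=> x; apply: dprod_ext => w; apply: scale1r. Qed.
Fact dprod_scaleDr : right_distributive dprod_scale +%R.
Proof. by move=> a x y; apply: dprod_ext => w; apply: scalerDr. Qed.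
Fact dprod_scaleDl x : {morph dprod_scale^~ x : a b / a + b}.
Proof. by move=> a b; apply: dprod_ext => w; apply: scalerDl. Qed.

HB.instance Definition _ := GRing.Zmodule_isLmodule.Build R dprod
  dprod_scaleA dprod_scale1 dprod_scaleDr dprod_scaleDl.

End Product.

Section DirectSum.
Variables (R : nzRingType) (W : choiceType) (Q : W -> lmodType R).

Definition finsupp_sub : submodule (dprod Q).
Proof.
exists (fun x : dprod Q => exists s : seq W, forall w, w \notin s -> x w = 0).
  by exists [::].
move=> a x y [s sP] [t tP]; exists (s ++ t) => w.
rewrite mem_cat negb_or => /andP[/sP xw /tP yw].
rewrite /GRing.add/= /dprod_add /GRing.scale/= /dprod_scale.
by rewrite xw yw scaler0 addr0.
Defined.

Definition dsum := sub_mod finsupp_sub.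

Definition component w (x : dsum) : Q w := incl finsupp_sub x w.

Fact component_is_linear w : linear (component w).
Proof. by move=> a x y; rewrite /component linearP. Qed.
HB.instance Definition _ w := GRing.isLinear.Build R dsum (Q w) *:%R
  (component w) (component_is_linear w).

Lemma dsum_ext (x y : dsum) :
  (forall w, component w x = component w y) -> x = y.
Proof.
by move=> xy; apply: incl_inj; apply: dprod_ext => w; apply: xy.
Qed.

Lemma dsum_finite (x : dsum) :
  exists2 s : seq W, uniq s & forall w, w \notin s -> component w x = 0.
Proof.
have [s sP] := inclP x; exists (undup s); first exact: undup_uniq.
by move=> w; rewrite mem_undup; apply: sP.
Qed.

Definition inj_fun w (q : Q w) : dprod Q := dfwith (fun v => 0 : Q v) q.

Fact inj_fun_finsupp w (q : Q w) : finsupp_sub (inj_fun q).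
Proof.
exists [:: w] => v; rewrite inE => vw; rewrite /inj_fun dfwith_out //.
by rewrite eq_sym.
Qed.

Definition dinj w (q : Q w) : dsum := lift_sub (inj_fun_finsupp q).

Lemma component_dinj w (q : Q w) : component w (dinj q) = q.
Proof. exact: dfwith_in. Qed.

Lemma component_dinj_out w (q : Q w) v : w != v -> component v (dinj q) = 0.
Proof. by move=> wv; rewrite /component /=/inj_fun dfwith_out. Qed.

Fact dinj_is_linear w : linear (@dinj w).
Proof.
move=> a x y; apply: dsum_ext => v; rewrite linearP /=.
have [<-|wv] := eqVneq w v; first by rewrite !component_dinj.
by rewrite !component_dinj_out // scaler0 addr0.
Qed.
HB.instance Definition _ w := GRing.isLinear.Build R (Q w) dsum *:%R (@dinj w)
  (@dinj_is_linear w).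

Lemma dsum_decomp (x : dsum) (s : seq W) : uniq s ->
  (forall w, w \notin s -> component w x = 0) ->
  x = \sum_(w <- s) dinj (component w x).
Proof.
move=> s_uniq sP; apply: dsum_ext => v; rewrite raddf_sum /=.
have [vs|vs] := boolP (v \in s); last first.
  rewrite sP // big_seq big1 // => w ws; rewrite component_dinj_out //.
  by apply: contraNneq vs => <-.
rewrite (bigD1_seq v) //= component_dinj big1 ?addr0 // => w wv.
by rewrite component_dinj_out.
Qed.

(** An element is the finite sum of its components; membership in a submodule is
    checked on them. *)
Lemma dsum_ind (S : submodule dsum) (x : dsum) :
  (forall w, component w x != 0 -> S (dinj (component w x))) -> S x.
Proof.
move=> Sx; have [s s_uniq sP] := dsum_finite x; rewrite (dsum_decomp s_uniq sP).
apply: carrier_sum => w.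
have [->|] := eqVneq (component w x) 0; last exact: Sx.
by rewrite raddf0; apply: carrier0.
Qed.

Lemma dsum_elim (B : lmodType R) (h : forall w, {linear Q w -> B}) :
  exists f : {linear dsum -> B}, forall w q, f (dinj q) = h w q.
Proof.
have sumE (x : dsum) (s t : seq W) : uniq s -> uniq t ->
    (forall w, w \notin s -> component w x = 0) ->
    (forall w, w \notin t -> component w x = 0) ->
    \sum_(w <- s) h w (component w x) = \sum_(w <- t) h w (component w x).
  move=> su tu sP tP; apply: perm_big_supp; apply: uniq_perm.
  - exact: filter_uniq.
  - exact: filter_uniq.
  move=> w; rewrite !mem_filter /=.
  case: (eqVneq (h w (component w x)) 0) => //= hw.
  by apply/idP/idP => _; apply: contraNT hw;
    [move/tP|move/sP] => ->; rewrite raddf0.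
pose P x b := exists s, [/\ uniq s, forall w, w \notin s -> component w x = 0 &
  \sum_(w <- s) h w (component w x) = b].
have [|||f fP] := @linear_choice _ dsum B P.
- move=> y; have [s su sP] := dsum_finite y.
  by exists (\sum_(w <- s) h w (component w y)); exists s.
- by move=> x y y' [s [su sP <-]] [t [tu tP <-]]; apply: sumE.
- move=> a x y x' y' [s [su sP <-]] [t [tu tP <-]].
  have ru : uniq (undup (s ++ t)) by exact: undup_uniq.
  have xP w : w \notin undup (s ++ t) -> component w x = 0.
    by rewrite mem_undup mem_cat negb_or => /andP[/sP].
  have yP w : w \notin undup (s ++ t) -> component w y = 0.
    by rewrite mem_undup mem_cat negb_or => /andP[_ /tP].
  exists (undup (s ++ t)); split=> // [w rw|].
    by rewrite linearP /= xP // yP // scaler0 addr0.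
  rewrite (sumE x _ _ su ru sP xP) (sumE y _ _ tu ru tP yP).
  rewrite scaler_sumr -big_split.
  by apply: eq_bigr => w _; rewrite !linearP.
exists f => w q; have [s [su sP <-]] := fP (dinj q).
rewrite (sumE _ s [:: w]) //; first by rewrite big_seq1 component_dinj.
by move=> v; rewrite inE eq_sym => /component_dinj_out.
Qed.

Lemma dsum_eq (B : lmodType R) (f g : {linear dsum -> B}) :
  (forall w (q : Q w), f (dinj q) = g (dinj q)) -> f =1 g.
Proof.
move=> fg x; have [s su sP] := dsum_finite x.
by rewrite (dsum_decomp su sP) !raddf_sum; apply: eq_bigr => w _; apply: fg.
Qed.

Lemma dsum_projective : (forall w, projective (Q w)) -> projective dsum.
Proof.
move=> Qproj A B f g fs.
have ex w : exists h : {linear Q w -> A}, forall q, f (h q) = g (dinj q).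
  exact: Qproj (g \o @dinj w : {linear Q w -> B}) fs.
pose h w := projT1 (cid (ex w)).
have hP w q : f (h w q) = g (dinj q) by rewrite /h; case: cid.
have [H HE] := dsum_elim h; exists H => x.
by apply: (@dsum_eq _ (f \o H : {linear _ -> _}) g) => w q /=; rewrite HE hP.
Qed.

End DirectSum.

Section Projective.
Variable R : nzRingType.

Lemma projective_lift_on (P V G : lmodType R) (A : submodule V) (pi : V -> G)
    (g : {linear P -> G}) :
  projective P -> lin_on A pi -> (forall y, exists2 x, A x & pi x = y) ->
  exists h : {linear P -> V}, forall p, A (h p) /\ pi (h p) = g p.
Proof.
move=> Pproj pilin pisurj.
have [q qE] := lin_on_restrict pilin.
have [|h hP] := Pproj _ _ q g.
  by move=> y; have [x Ax <-] := pisurj y; exists (lift_sub Ax); rewrite qE.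
exists (incl A \o h : {linear _ -> _}) => p /=; split; first exact: inclP.
by rewrite -hP qE.
Qed.

End Projective.

(** * Well-ordered filtrations *)

Definition strict_well_order (W : Type) (lt : W -> W -> Prop) : Prop :=
  [/\ well_founded lt, forall u v w, lt u v -> lt v w -> lt u w &
      forall u v, [\/ lt u v, u = v | lt v u]].

Lemma exists_strict_well_order (W : eqType) :
  exists lt : W -> W -> Prop, strict_well_order lt.
Proof.
have [le le_wo] := well_ordering_principle W.
have leW : wo_chain le predT by move=> A _; apply: le_wo.
have le_total x y : le x y || le y x by exact: (wo_chainW leW).
have le_anti x y : le x y -> le y x -> x = y.
  by move=> xy yx; apply: (wo_chain_antisymmetric leW) => //; rewrite xy yx.
have minP (P : W -> Prop) : (exists x, P x) ->
    exists2 m, P m & forall x, P x -> le m x.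
  move=> [x Px]; have [|m [[/asboolP Pm lem] _]] := le_wo [pred x | `[< P x >]].
    by exists x; apply/asboolP.
  by exists m => // y Py; apply: lem; apply/asboolP.
exists (fun x y => le x y /\ x <> y); split.
- move=> x; apply: contrapT => xN.
  have [m mN mmin] := minP _ (ex_intro (fun x => ~ Acc _ x) x xN).
  apply: mN; constructor=> y [ym ynm]; apply: contrapT => yN.
  by apply: ynm; apply: le_anti => //; apply: mmin.
- move=> u v w [uv nuv] [vw nvw].
  (* Transitivity is read off the least element of {u, v, w}. *)
  have [|m mP mmin] := minP (fun x => [\/ x = u, x = v | x = w]).
    by exists u; constructor 1.
  have uw : le u w.
    have [mu|mv|mw] := mP; first by rewrite -mu; apply: mmin; constructor 3.
      case: nuv; apply: le_anti => //.
      by rewrite -mv; apply: mmin; constructor 1.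
    case: nvw; apply: le_anti => //.
    by rewrite -mw; apply: mmin; constructor 2.
  by split=> // uw'; apply: nuv; apply: le_anti => //; rewrite uw'.
- move=> u v; have [->|uv] := EM (u = v); first by constructor 2.
  have /orP[uv'|vu] := le_total u v; first by constructor 1.
  by constructor 3; split=> // /esym.
Qed.

Section Filtration.
Variables (R : nzRingType) (W : choiceType) (lt : W -> W -> Prop).
Hypothesis lt_wo : strict_well_order lt.
Implicit Types V X : lmodType R.

(** Filtrations are indexed by a well-ordered type and start from a base [B].
    Only the union of the earlier stages is ever compared with a given stage,
    so no continuity condition at limit indices has to be imposed. *)
Definition union V (B : submodule V) (A : W -> submodule V) (U : W -> Prop)
  (x : V) := B x \/ exists2 v, U v & A v x.

Definition below V (B : submodule V) (A : W -> submodule V) (w : W) :=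
  union B A (lt^~ w).

Definition increasing V (B : submodule V) (A : W -> submodule V) : Prop :=
  (forall v w x, lt v w -> A v x -> A w x) /\ (forall w x, B x -> A w x).

Definition filtration V (B : submodule V) (A : W -> submodule V) : Prop :=
  increasing B A /\ forall x, union B A (fun=> True) x.

Let lt_wf : well_founded lt. Proof. by case: lt_wo. Qed.
Let lt_trans u v w : lt u v -> lt v w -> lt u w.
Proof. by have [_ h _] := lt_wo; apply: h. Qed.
Let lt_total u v : [\/ lt u v, u = v | lt v u].
Proof. by have [_ _ h] := lt_wo; apply: h. Qed.

Lemma lt_irr u : ~ lt u u.
Proof. by elim/(well_founded_ind lt_wf): u => u IH uu; apply: (IH u). Qed.

Lemma lt_ex_min (P : W -> Prop) : (exists w, P w) ->
  exists2 w, P w & forall v, lt v w -> ~ P v.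
Proof.
move=> [w Pw]; apply: contrapT => noMin.
elim/(well_founded_ind lt_wf): w Pw => w IH Pw.
by apply: noMin; exists w => // v vw Pv; apply: IH vw Pv.
Qed.

Section Theory.
Variables (V : lmodType R) (B : submodule V) (A : W -> submodule V).
Hypothesis incr : increasing B A.

Lemma below_sub w x : below B A w x -> A w x.
Proof. by have [Amono AB] := incr; case=> [/AB //|[v vw]]; apply: Amono. Qed.

Lemma union_common (U : W -> Prop) x y : union B A U x -> union B A U y ->
  (B x /\ B y) \/ (exists v, [/\ U v, A v x & A v y]).
Proof.
have [Amono AB] := incr.
case=> [Bx|[u Uu Ax]]; case=> [By|[v Uv Ay]].
- by left.
- by right; exists v; split=> //; apply: AB.
- by right; exists u; split=> //; apply: AB.
- right; have [uv|uv|vu] := lt_total u v.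
  + by exists v; split=> //; apply: Amono uv _.
  + by exists v; split=> //; rewrite -uv.
  + by exists u; split=> //; apply: Amono vu _.
Qed.

Lemma union_lin U a x y :
  union B A U x -> union B A U y -> union B A U (a *: x + y).
Proof.
move=> Ux Uy; have [[Bx By]|[v [vw Ax Ay]]] := union_common Ux Uy.
  by left; apply: carrier_lin.
by right; exists v => //; apply: carrier_lin.
Qed.

Definition union_sub U : submodule V :=
  @Submodule _ V (union B A U) (or_introl (carrier0 B)) (@union_lin U).

Lemma filtration_level x : filtration B A ->
  B x \/ exists2 w, A w x & ~ below B A w x.
Proof.
move=> [_ /(_ x)[Bx|[u _ Au]]]; first by left.
have [Bx|nBx] := EM (B x); first by left.
have [w Aw wmin] := lt_ex_min (ex_intro (A^~ x) u Au).
by right; exists w => //; case=> // -[v /wmin].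
Qed.

Section Glue.
Variables (X : lmodType R) (f0 : V -> X).

(** The common extension of the maps [F v], for [v] in [U], and of [f0]; the
    choice of a stage does not matter once these maps are coherent. *)
Definition glue (U : W -> Prop) (F : W -> V -> X) (x : V) : X :=
  if pselect (exists v, U v /\ A v x) is left e then F (projT1 (cid e)) x
  else f0 x.

Definition coherent (U : W -> Prop) (F : W -> V -> X) : Prop :=
  [/\ forall v, U v -> lin_on (A v) (F v),
      forall v x, U v -> B x -> F v x = f0 x &
      forall u v x, U u -> U v -> lt u v -> A u x -> F v x = F u x].

Variables (U : W -> Prop) (F : W -> V -> X).
Hypothesis Fcoh : coherent U F.

Lemma glueE v x : U v -> A v x -> glue U F x = F v x.
Proof.
move=> Uv Av; rewrite /glue; case: pselect => [e|[]]; last by exists v.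
case: cid => /= u [Uu Au]; have [_ _ Fuv] := Fcoh.
by have [uv|->//|vu] := lt_total u v; [rewrite (Fuv u v)|rewrite (Fuv v u)].
Qed.

Lemma glue_base x : B x -> glue U F x = f0 x.
Proof.
have [_ FB _] := Fcoh.
move=> Bx; rewrite /glue; case: pselect => // e.
by case: cid => /= u [Uu _]; apply: FB.
Qed.

Lemma glue_lin : lin_on B f0 ->
  lin_on (union B A U) (glue U F).
Proof.
move=> f0lin a x y Ux Uy; have [Flin _ _] := Fcoh.
have [[Bx By]|[v [Uv Ax Ay]]] := union_common Ux Uy.
  by rewrite !glue_base ?f0lin //; apply: carrier_lin.
by rewrite !(glueE Uv) ?Flin //; apply: carrier_lin.
Qed.

End Glue.

(** Transfinite recursion: a linear map is built stage by stage. The predicate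
    [adm] carries what each stage promises to the later ones. *)
Lemma extend_along_filtration X (f0 : V -> X) (adm : W -> V -> X -> Prop) :
  filtration B A -> lin_on B f0 ->
  (forall w f, lin_on (below B A w) f -> (forall x, B x -> f x = f0 x) ->
     (forall v x, lt v w -> A v x -> adm v x (f x)) ->
     exists g, [/\ lin_on (A w) g, forall x, below B A w x -> g x = f x &
                   forall x, A w x -> adm w x (g x)]) ->
  exists f : {linear V -> X},
    (forall x, B x -> f x = f0 x) /\ (forall w x, A w x -> adm w x (f x)).
Proof.
move=> [_ Aex] f0lin step; have [Amono AB] := incr.
have ex w f : exists g,
    lin_on (below B A w) f -> (forall x, B x -> f x = f0 x) ->
    (forall v x, lt v w -> A v x -> adm v x (f x)) ->
    [/\ lin_on (A w) g, forall x, below B A w x -> g x = f x &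
        forall x, A w x -> adm w x (g x)].
  have [[h1 h2 h3]|n] := EM [/\ lin_on (below B A w) f,
      forall x, B x -> f x = f0 x &
      forall v x, lt v w -> A v x -> adm v x (f x)].
    by have [g gP] := step w f h1 h2 h3; exists g.
  by exists f => h1 h2 h3; case: n.
(* The recursion runs over total functions: a chosen extension operator is
   applied to the function glued from the earlier stages. *)
pose ext w f := projT1 (cid (ex w f)).
pose body w (rec : forall v, lt v w -> V -> X) : V -> X :=
  ext w (glue f0 (lt^~ w)
    (fun v => if pselect (lt v w) is left h then rec v h else f0)).
pose F := Fix lt_wf (fun=> V -> X) body.
have FE w : F w = ext w (glue f0 (lt^~ w) F).
  rewrite /F Fix_eq -/F /body.
    congr (ext w _); apply: funext => x; rewrite /glue; case: pselect => // e.
    by case: cid => /= v [vw _]; case: pselect.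
  move=> v f g fg; congr (ext v _); apply: funext => x; rewrite /glue.
  case: pselect => // e; case: cid => /= u [uv _].
  by case: pselect => // h; rewrite fg.
have FP w : [/\ lin_on (A w) (F w), forall x, B x -> F w x = f0 x,
    forall v x, lt v w -> A v x -> F w x = F v x &
    forall x, A w x -> adm w x (F w x)].
  elim/(well_founded_ind lt_wf): w => w IH.
  have coh : coherent f0 (lt^~ w) F.
    split=> [v /IH[]//|v x /IH[_ h _ _]|u v x uw /IH[_ _ h _]]; exact: h.
  have := projT2 (cid (ex w (glue f0 (lt^~ w) F))).
  rewrite -/(ext w _) -FE => -[||v x vw Ax|gl gE gadm].
  - exact: glue_lin.
  - by move=> x Bx; apply: glue_base coh _ Bx.
  - by rewrite (glueE coh vw Ax); have [_ _ _ h] := IH v vw; apply: h.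
  split=> // [x Bx|v x vw Ax].
    by rewrite gE; [exact: glue_base coh _ Bx|left].
  by rewrite gE ?(glueE coh vw Ax)//; right; exists v.
have coh : coherent f0 (fun=> True) F.
  by split=> [v _|v x _ Bx|u v x _ _ uv Ax]; have [h1 h2 h3 _] := FP v;
    [|apply: h2|apply: h3].
have [f fE] := @linear_of _ V X (glue f0 (fun=> True) F)
  (fun a x y => glue_lin coh f0lin a (Aex x) (Aex y)).
exists f; split=> [x Bx|w x Ax]; rewrite fE; first exact: glue_base coh _ Bx.
by rewrite (glueE coh (v := w)) //; have [_ _ _ h] := FP w; apply: h.
Qed.

End Theory.
End Filtration.

(** * Filtered modules and vanishing of Ext^1 *)

Section Filtered.
Variable R : nzRingType.
Implicit Types V X M G : lmodType R.
Implicit Types Phi Psi : lmodType R -> Prop.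

(** [pi], which only matters on [A], identifies [A / B] with [G]. *)
Definition subquotient V (A : submodule V) (B : V -> Prop) G (pi : V -> G) :=
  [/\ lin_on A pi, forall y, exists2 x, A x & pi x = y,
      forall x, A x -> (pi x = 0 <-> B x) & forall x, B x -> A x].

Definition filtered Phi M : Prop :=
  exists (W : choiceType) (lt : W -> W -> Prop) (A : W -> submodule M),
    [/\ strict_well_order lt, filtration lt (zero_sub M) A &
        forall w, exists G (pi : M -> G),
          Phi G /\ subquotient (A w) (below lt (zero_sub M) A w) pi].

Definition syzygy Psi G : Prop :=
  exists (K F : lmodType R) (i : {linear K -> F}) (p : {linear F -> G}),
    [/\ projective F, short_exact i p & Psi K].

Definition cosyzygy Psi G : Prop :=
  exists (F C : lmodType R) (i : {linear G -> F}) (p : {linear F -> C}),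
    [/\ projective F, short_exact i p & Psi C].

(** Ext^1(G, X) = 0, stated without the group Ext^1: maps to [X] extend along
    every monomorphism with cokernel [G]. *)
Definition ext1_zero G X : Prop :=
  forall (K F : lmodType R) (i : {linear K -> F}) (p : {linear F -> G}),
    short_exact i p ->
    forall h : {linear K -> X}, exists k : {linear F -> X},
      forall x, k (i x) = h x.

Lemma lin_onB V X (S : submodule V) (f : V -> X) x y :
  lin_on S f -> S x -> S y -> f (x - y) = f x - f y.
Proof. by move=> fl Sx Sy; rewrite addrC -scaleN1r fl // scaleN1r addrC. Qed.

Lemma ext1_on G X V (A : submodule V) (B : V -> Prop)
    (pi : V -> G) (f : V -> X) :
  ext1_zero G X -> subquotient A B pi -> lin_on B f ->
  exists g : V -> X, lin_on A g /\ forall x, B x -> g x = f x.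
Proof.
move=> GX [pilin pisurj piker BA] flin.
have [q qE] := lin_on_restrict pilin.
have kerB (z : sub_mod (ker_sub q)) : B (incl A (incl _ z)).
  by apply/piker; [exact: inclP|rewrite -qE; exact: (inclP z)].
have [h hE] : exists h : {linear sub_mod (ker_sub q) -> X},
    forall z, h z = f (incl A (incl _ z)).
  by apply: linear_of => a x y; rewrite !linearP; apply: flin (kerB x) (kerB y).
have [|k kE] := GX _ _ _ q (kernel_exact _) h.
  by move=> y; have [x Ax <-] := pisurj y; exists (lift_sub Ax); rewrite qE.
exists (fun x => if pselect (A x) is left Ax then k (lift_sub Ax) else 0).
split.
  move=> a x y Ax Ay; case: pselect => [Axy|[]]; last exact: carrier_lin.
  do 2!case: pselect => // ?.
  by rewrite -linearP; congr (k _); apply: incl_inj; rewrite linearP.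
move=> x Bx; case: pselect => [Ax|/(_ (BA _ Bx))//].
have qx : ker_sub q (lift_sub Ax) by rewrite /= qE; apply/piker.
by rewrite -[lift_sub Ax](lift_subK (S := ker_sub q) qx) kE hE.
Qed.

(** A map given on the kernel of [p : F -> M] is extended to [F] along the
    filtration of [F] by the preimages of the stages of [M], whose base is that
    kernel and whose factors are those of [M]. *)
Lemma eklof M X : filtered (ext1_zero^~ X) M -> ext1_zero M X.
Proof.
move=> [W [lt [A [lt_wo [[Amono A0] Aex] Afac]]]] N F i p [i_inj ip ps] h.
pose A' w := preim_sub p (A w).
have incr : increasing lt (ker_sub p) A'.
  split=> [v w x vw|w x px]; first exact: Amono.
  by rewrite /A' /= px; apply: carrier0.
have filt' : filtration lt (ker_sub p) A'.
  by split=> // x; have [] := Aex (p x); [left|right].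
have ex x : exists y, ker_sub p x -> exists2 n, i n = x & y = h n.
  have [px|npx] := EM (ker_sub p x); last by exists 0.
  by have /ip[n nx] := px; exists (h n) => _; exists n.
have [f0 f0P] := choice ex.
have f0E n : f0 (i n) = h n.
  by have [|m /i_inj -> ->//] := f0P (i n); apply/ip; exists n.
have f0lin : lin_on (ker_sub p) f0.
  by move=> a x y /ip[m <-] /ip[n <-]; rewrite -linearP !f0E linearP.
have [|f [fB _]] := @extend_along_filtration _ _ _ lt_wo _ _ _ incr X f0
    (fun _ _ _ => True) filt' f0lin.
  move=> w f flin fB _; have [G [pi [GX [pilin pisurj piker piB]]]] := Afac w.
  have sq : subquotient (A' w) (below lt (ker_sub p) A' w) (pi \o p).
    split.
    - by move=> a x y Ax Ay; rewrite /= linearP pilin.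
    - move=> y; have [x Ax <-] := pisurj y; have [z zx] := ps x.
      by exists z; rewrite /A' /= zx.
    - by move=> x Ax; apply: piker.
    - by move=> x; apply: piB.
  have [g [glin gE]] := ext1_on GX sq flin.
  by exists g; split.
by exists f => n; rewrite fB ?f0E //; apply/ip; exists n.
Qed.

Section Upto.
Variables (W : choiceType) (lt : W -> W -> Prop) (lt_wo : strict_well_order lt).
Variable Q : W -> lmodType R.

(** The direct sum of the [Q v] over [v <= w]; these submodules filter [dsum Q]
    with factors [Q w]. *)
Definition upto (w : W) : submodule (dsum Q).
Proof.
exists (fun x => forall v, lt w v -> component v x = 0).
  by move=> v _; rewrite raddf0.
by move=> a x y wx wy v wv; rewrite linearP /= wx ?wy // scaler0 addr0.
Defined.

Lemma upto_dinj w (q : Q w) : upto w (dinj q).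
Proof.
move=> v wv; rewrite component_dinj_out //; apply/eqP => wv'.
by apply: (lt_irr lt_wo (u := w)); rewrite {2}wv'.
Qed.

Lemma upto_increasing : increasing lt (zero_sub (dsum Q)) upto.
Proof.
have [_ trans _] := lt_wo.
split=> [v w x vw vx u wu|w x ->]; last by move=> v _; rewrite raddf0.
by apply: vx; apply: trans wu.
Qed.

Lemma upto_filtration : filtration lt (zero_sub (dsum Q)) upto.
Proof.
split=> [|x]; first exact: upto_increasing.
apply: (dsum_ind (S := union_sub lt_wo upto_increasing (fun=> True))) => w _.
by right; exists w => //; apply: upto_dinj.
Qed.

(** As supports are finite, an element of [upto w] that vanishes at [w] already
    appears strictly before [w]. *)
Lemma below_upto w x : upto w x ->
  (component w x = 0 <-> below lt (zero_sub (dsum Q)) upto w x).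
Proof.
have [_ _ total] := lt_wo.
move=> wx; split=> [xw|[->|[v vw vx]]]; last first.
- exact: vx.
- by rewrite raddf0.
apply: (dsum_ind (S := union_sub lt_wo upto_increasing (lt^~ w))) => v xv.
have [vw|vw|wv] := total v w.
- by right; exists v => //; apply: upto_dinj.
- by move: xv; rewrite vw xw eqxx.
- by move: xv; rewrite wx // eqxx.
Qed.

End Upto.
End Filtered.

(** * Syzygies of filtered modules *)

Section Horseshoe.
Variable R : nzRingType.
Implicit Types V X M G : lmodType R.
Implicit Types Phi Psi : lmodType R -> Prop.

Lemma subquotient_sub V (A : submodule V) (B : V -> Prop) G (pi : V -> G) x y :
  subquotient A B pi -> A x -> A y -> pi x = pi y -> B (x - y).
Proof.
move=> [pilin _ piker _] Ax Ay xy; apply/piker; first exact: carrierB.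
by rewrite (lin_onB pilin) // xy subrr.
Qed.

(** What is chosen at one stage of the horseshoe construction, gathered in a
    record because all of it has to be chosen together. *)
Record projective_stage V (A : submodule V) (B : V -> Prop) Psi := ProjStage {
  st_G : lmodType R; st_K : lmodType R; st_F : lmodType R;
  st_pi : V -> st_G;
  st_i : {linear st_K -> st_F}; st_p : {linear st_F -> st_G};
  st_lift : {linear st_F -> V};
  st_sub : subquotient A B st_pi;
  st_proj : projective st_F; st_ses : short_exact st_i st_p; st_Psi : Psi st_K;
  st_liftP : forall q, A (st_lift q) /\ st_pi (st_lift q) = st_p q
}.

Arguments st_liftP {V A B Psi} p q.

(** The filtered horseshoe lemma. The surjections of projective modules [F_w]
    onto the factors lift to maps [F_w -> A w], which together define a
    surjection [phi] from the direct sum onto [M]. Taking the component at [w]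
    identifies the factor at [w] of its kernel with the kernel of
    [F_w -> A w / A_(<w)]. *)
Lemma filtered_syzygy Psi M :
  filtered (syzygy Psi) M -> syzygy (filtered Psi) M.
Proof.
move=> [W [lt [A [lt_wo Afilt Afac]]]].
have [[Amono A0] Aex] := Afilt.
have stage w : exists _ :
    projective_stage (A w) (below lt (zero_sub M) A w) Psi, True.
  have [G [pi [[K [F [i [p [Fproj ses KPsi]]]]] sq]]] := Afac w.
  have [pilin pisurj _ _] := sq.
  have [h hP] := projective_lift_on p Fproj pilin pisurj.
  by exists (ProjStage sq Fproj ses KPsi hP).
pose s w := projT1 (cid (stage w)).
pose Q w := st_F (s w).
pose P := upto lt Q.
have [phi phiE] := dsum_elim (fun w => st_lift (s w)).
have Pincr : increasing lt (zero_sub (dsum Q)) P by exact: upto_increasing.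
have Pd w (q : Q w) : P w (dinj q) by exact: upto_dinj.
have phiA w q : P w q -> A w (phi q).
  move=> wq; apply: (dsum_ind (S := preim_sub phi (A w))) => v qv.
  rewrite /= phiE; have [_ _ /(_ v w)] := lt_wo.
  have Av q' : A v (st_lift (s v) q') by have [] := st_liftP (s v) q'.
  by case=> [/Amono|<-//|wv]; [exact|rewrite wq ?eqxx in qv].
have phi_below w q :
    below lt (zero_sub _) P w q -> below lt (zero_sub M) A w (phi q).
  by case=> [->|[v vw /phiA Av]]; [left; rewrite /= raddf0|right; exists v].
have phi_surj w x : A w x -> exists2 q, P w q & phi q = x.
  elim/(well_founded_ind (let: And3 h _ _ := lt_wo in h)): w x => w IH x Ax.
  have [_ _ ps] := st_ses (s w); have [q qx] := ps (st_pi (s w) x).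
  have [Aq piq] := st_liftP (s w) q.
  have := subquotient_sub (st_sub (s w)) Ax Aq (etrans (esym qx) (esym piq)).
  case=> [/eqP|[v vw /(IH v vw)[r vr rE]]].
    rewrite subr_eq0 => /eqP ->.
    by exists (dinj q); [exact: Pd|rewrite phiE].
  exists (r + dinj q); last by rewrite raddfD /= rE phiE subrK.
  by apply: carrierD (Pd _ _); have [Pm _] := Pincr; apply: Pm vw vr.
have below_surj w x : below lt (zero_sub M) A w x ->
    exists2 q, below lt (zero_sub _) P w q & phi q = x.
  case=> [->|[v vw /phi_surj[q Pq <-]]].
    by exists 0; [left|exact: raddf0].
  by exists q => //; right; exists v.
exists (sub_mod (ker_sub phi)), (dsum Q), (incl (ker_sub phi)), phi; split.
- by apply: dsum_projective => w; apply: st_proj.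
- apply: kernel_exact => x.
  have [->|[w _ /phi_surj[q _ <-]]] := Aex x; last by exists q.
  by exists 0; rewrite raddf0.
exists W, lt, (fun w => preim_sub (incl (ker_sub phi)) (P w)); split=> //.
  split; first split=> [v w x|w x ->].
  - by have [Pm _] := Pincr; apply: Pm.
  - exact: carrier0.
  move=> x; have [_ Pex] := upto_filtration lt_wo Q.
  have [x0|[w _ wx]] := Pex (incl (ker_sub phi) x).
    by left; apply: incl_inj; rewrite raddf0.
  by right; exists w.
move=> w; have [i_inj ip _] := st_ses (s w).
have [pilin _ piker piB] := st_sub (s w).
(* As [phi x = 0], the image of the component of [x] at [w] is, up to sign, that
   of the earlier components; it lies below [w], so [st_p (s w)] kills the
   component. *)
have ex (x : sub_mod (ker_sub phi)) : exists k, P w (incl _ x) ->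
    st_i (s w) k = component w (incl _ x).
  have [wx|n] := EM (P w (incl _ x)); last by exists 0.
  suff /ip[k kE] : st_p (s w) (component w (incl _ x)) = 0 by exists k.
  have [Aq <-] := st_liftP (s w) (component w (incl _ x)); apply/piker => //.
  have : below lt (zero_sub _) P w (dinj (component w (incl _ x)) - incl _ x).
    apply/below_upto => //; first exact: carrierB.
    by rewrite raddfB /= component_dinj subrr.
  by move/phi_below; rewrite raddfB /= phiE (inclP x) subr0.
have [f fP] := choice ex.
exists (st_K (s w)), f; split; first exact: st_Psi.
have belowE x :
    below lt (zero_sub _) (fun w => preim_sub (incl (ker_sub phi)) (P w)) w x
    <-> below lt (zero_sub _) P w (incl _ x).
  split; case=> [x0|[v vw vx]]; try by right; exists v.
    by left; rewrite x0; exact: raddf0.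
  by left; apply: incl_inj; rewrite raddf0.
split.
- move=> a x y wx wy; apply: i_inj; rewrite linearP !fP //.
  exact: (carrier_lin a wx wy).
- move=> k; have [Ak pik] := st_liftP (s w) (st_i (s w) k).
  have : st_p (s w) (st_i (s w) k) = 0 by apply/ip; exists k.
  move=> pk; move: pik; rewrite pk => /piker -/(_ Ak)/below_surj[q qb qE].
  have wq : P w q by exact: (below_sub Pincr).
  have dP := Pd w (st_i (s w) k).
  (* An element of the kernel of [st_p (s w)] is corrected by earlier components
     so as to be annihilated by [phi]. *)
  have xker : ker_sub phi (dinj (Q := Q) (st_i (s w) k) - q).
    by rewrite /= raddfB /= phiE qE subrr.
  have wx : P w (dinj (Q := Q) (st_i (s w) k) - q) by exact: carrierB.
  exists (lift_sub xker) => //; apply: i_inj; rewrite fP // lift_subK raddfB /=.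
  by move/(below_upto lt_wo wq): qb => ->; rewrite component_dinj subr0.
- move=> x wx; split=> [fx|/belowE bx].
    by apply/belowE/below_upto => //; rewrite -fP // fx raddf0.
  by apply: i_inj; rewrite fP // raddf0; apply/(below_upto lt_wo).
- by move=> x /belowE/(below_sub Pincr).
Qed.

End Horseshoe.

(** * Cosyzygies of filtered modules *)

Section Cohorseshoe.
Variable R : nzRingType.
Implicit Types V X M G : lmodType R.
Implicit Types Phi Psi : lmodType R -> Prop.

Lemma cokernel_exists V (S : submodule V) :
  exists (C : lmodType R) (p : {linear V -> C}),
    surj p /\ forall x, p x = 0 <-> S x.
Proof.
pose I : submodClosed V := GRing.SubmodClosed.clone R V (in_sub S) _.
exists (quot_mod I), (@quot_proj R V I); split=> [q|x].
  by exists (quot_repr q); exact: quot_reprK.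
by rewrite -(raddf0 (@quot_proj R V I)) quot_projP subr0; split=> /asboolP.
Qed.

Section Truncation.
Variables (W : choiceType) (lt : W -> W -> Prop) (lt_wo : strict_well_order lt).
Variable Q : W -> lmodType R.

Lemma truncation w : exists t : {linear dsum Q -> dsum Q},
  (forall x, below lt (zero_sub _) (upto lt Q) w (t x)) /\
  (forall x, below lt (zero_sub _) (upto lt Q) w x -> t x = x).
Proof.
have ex v : exists h : {linear Q v -> dsum Q},
    forall q, (lt v w -> h q = dinj q) /\ (~ lt v w -> h q = 0).
  have [vw|vw] := EM (lt v w); first by exists (@dinj _ _ _ v).
  by exists (\0 : {linear _ -> _}).
pose h v := projT1 (cid (ex v)).
have [t tE] := dsum_elim h.
have tin v q : lt v w -> t (dinj (w := v) q) = dinj q.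
  by move=> vw; rewrite tE /h; case: cid => /= k /(_ q)[->].
have tout v q : ~ lt v w -> t (dinj (w := v) q) = 0.
  by move=> vw; rewrite tE /h; case: cid => /= k /(_ q)[_ ->].
have [_ trans total] := lt_wo.
exists t; split=> x.
  pose S := union_sub lt_wo (upto_increasing lt_wo Q) (lt^~ w).
  apply: (dsum_ind (S := preim_sub t S)) => v _ /=.
  have [vw|vw] := EM (lt v w); last by rewrite tout //; exact: (carrier0 S).
  by rewrite tin //; right; exists v => //; exact: upto_dinj.
case=> [->|[v vw vx]]; first exact: raddf0.
suff : ker_sub (t \- idfun : {linear dsum Q -> dsum Q}) x.
  by move/eqP; rewrite /= subr_eq0 => /eqP.
apply: dsum_ind => u ux; rewrite /= tin ?subrr //.
have [uv|->//|uv] := total u v; first exact: trans uv vw.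
by rewrite vx ?eqxx in ux.
Qed.

End Truncation.

Record embedding_stage V (A : submodule V) (B : V -> Prop) Phi Psi := EmbStage {
  em_G : lmodType R; em_F : lmodType R; em_C : lmodType R;
  em_pi : V -> em_G;
  em_i : {linear em_G -> em_F}; em_p : {linear em_F -> em_C};
  em_sub : subquotient A B em_pi; em_Phi : Phi em_G;
  em_proj : projective em_F; em_ses : short_exact em_i em_p; em_Psi : Psi em_C
}.

(** The embeddings [g w] of the factors in projectives [Q w] are assembled into
    a map [f] from [M] to the direct sum of the [Q w] whose restriction to
    [A w] has values in the sum over [v <= w] and last component [g w]. Letting
    each [g w] be extended to [M] separately would only give a map to the
    product. Each nonzero [x] has a nonzero component at its level, so [f] is
    injective, and strictly compatible with the filtrations; the factors of the
    cokernel are therefore the cokernels of the [g w]. *)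
Lemma filtered_cosyzygy Phi Psi M :
  (forall G, Phi G -> cosyzygy Psi G) ->
  (forall G Q, Phi G -> projective Q -> ext1_zero G Q) ->
  filtered Phi M -> cosyzygy (filtered Psi) M.
Proof.
move=> Phi_cosyz Phi_ext [W [lt [A [lt_wo Afilt Afac]]]].
have [lt_wf lt_trans lt_total] := lt_wo.
have [Aincr Aex] := Afilt; have [Amono A0] := Aincr.
have stage w : exists _ :
    embedding_stage (A w) (below lt (zero_sub M) A w) Phi Psi, True.
  have [G [pi [PhiG sq]]] := Afac w.
  have [F [C [i [p [Fproj ses PsiC]]]]] := Phi_cosyz G PhiG.
  by exists (EmbStage sq PhiG Fproj ses PsiC).
pose s w := projT1 (cid (stage w)).
pose Q w := em_F (s w).
pose P := upto lt Q.
pose g w x : Q w := em_i (s w) (em_pi (s w) x).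
have Pincr : increasing lt (zero_sub (dsum Q)) P by exact: upto_increasing.
have Pd w (q : Q w) : P w (dinj q) by exact: upto_dinj.
have g0 w x : A w x -> (g w x = 0 <-> below lt (zero_sub M) A w x).
  have [i_inj _ _] := em_ses (s w); have [_ _ piker _] := em_sub (s w).
  move=> Ax; rewrite -piker //; split=> [|pix]; last by rewrite /g pix raddf0.
  by rewrite /g -[RHS](raddf0 (em_i (s w))) => /i_inj.
have glin w : lin_on (A w) (g w).
  have [pilin _ _ _] := em_sub (s w).
  by move=> a x y Ax Ay; rewrite /g pilin // linearP.
have Qproj : projective (dsum Q) by apply: dsum_projective => w; apply: em_proj.
have [|w f flin fB fadm|f [_ fadm]] :=
  @extend_along_filtration _ _ _ lt_wo _ _ _ Aincr (dsum Q) (fun=> 0)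
    (fun w x q => P w q /\ component w q = g w x) Afilt.
- by move=> a x y _ _; rewrite scaler0 addr0.
- have fbelow x :
      below lt (zero_sub M) A w x -> below lt (zero_sub _) P w (f x).
    by case=> [/fB ->|[v vw /(fadm v _ vw)[]]]; [left|right; exists v].
  (* An extension [h] of [f] from the earlier stages to [A w] exists because
     Ext^1 vanishes; its components from [w] on are then replaced by [g w]. *)
  have [h [hlin hE]] :=
    ext1_on (Phi_ext _ _ (em_Phi (s w)) Qproj) (em_sub (s w)) flin.
  have [t [tbelow tE]] := truncation lt_wo Q w.
  exists (fun x => t (h x) + dinj (g w x)); split.
  + by move=> a x y Ax Ay; rewrite hlin // glin // !linearP scalerDr addrACA.
  + move=> x bx; rewrite hE // tE; last exact: fbelow.
    by rewrite (g0 w x (below_sub Aincr bx)).2 // raddf0 addr0.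
  + have Pt x : P w (t x) := below_sub Pincr (tbelow x).
    move=> x Ax; split; first by apply: carrierD.
    by rewrite raddfD /= component_dinj (below_upto lt_wo (Pt _)).2 ?add0r.
have f_level x :
    x = 0 \/ exists w, [/\ A w x, P w (f x) & component w (f x) <> 0].
  have [->|[w Ax nb]] := filtration_level lt_wo x Afilt; first by left.
  right; exists w; have [Pf ->] := fadm w x Ax; split=> //.
  by move/(g0 w x Ax).
have f_inj : injective f.
  move=> x y xy; apply/eqP; rewrite -subr_eq0; apply/eqP.
  have [//|[w [_ _]]] := f_level (x - y).
  by case; rewrite !raddfB /= xy subrr.
have f_reflect w x : P w (f x) -> A w x.
  move=> wfx; have [->|[u [Ax _ ux]]] := f_level x; first exact: carrier0.
  have [wu|->//|uw] := lt_total w u; last exact: Amono uw Ax.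
  by case: ux; apply: wfx.
have [C [p [ps pf]]] := cokernel_exists (im_sub f (full_sub M)).
have pf0 x : p (f x) = 0 by apply/pf; exists x.
exists (dsum Q), C, f, p; split=> //.
  by split=> // q; rewrite pf; split=> [[x _ <-]|[x <-]]; exists x.
exists W, lt, (fun w => im_sub p (P w)); split=> //.
  split; first split=> [v w c vw [q vq <-]|w c ->].
  - by exists q => //; have [Pm _] := Pincr; apply: Pm vq.
  - exact: carrier0.
  move=> c; have [q <-] := ps c.
  have [_ /(_ q)[->|[w _ wq]]] := upto_filtration lt_wo Q.
    by left; exact: raddf0.
  by right; exists w => //; exists q.
move=> w; have [i_inj ip pp] := em_ses (s w).
have [pilin pisurj piker piB] := em_sub (s w).
have quotE q q' : P w q -> P w q' -> p q = p q' ->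
    em_p (s w) (component w q) = em_p (s w) (component w q').
  move=> wq wq' /eqP; rewrite -subr_eq0 -raddfB => /eqP/pf[x _ xE].
  apply/eqP; rewrite -subr_eq0 -!raddfB /= -xE.
  have Ax : A w x by apply: f_reflect; rewrite xE; exact: carrierB.
  have [_ ->] := fadm w x Ax; apply/eqP/ip; by exists (em_pi (s w) x).
have quot_below q : P w q -> em_p (s w) (component w q) = 0 ->
    below lt (zero_sub _) (fun w => im_sub p (P w)) w (p q).
  move=> wq /ip[y yE]; have [x Ax xy] := pisurj y.
  have [Pf fE] := fadm w x Ax.
  have : below lt (zero_sub _) P w (q - f x).
    apply/(below_upto lt_wo); first exact: carrierB.
    by rewrite raddfB /= fE /g xy yE subrr.
  case=> [/eqP|[v vw vq]]; last first.
    by right; exists v => //; exists (q - f x); rewrite ?raddfB //= pf0 subr0.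
  by rewrite subr_eq0 => /eqP ->; left; rewrite /= pf0.
have ex c : exists y, im_sub p (P w) c ->
    exists q, [/\ P w q, p q = c & em_p (s w) (component w q) = y].
  have [[q wq qc]|n] := EM (im_sub p (P w) c); last by exists 0.
  by exists (em_p (s w) (component w q)) => _; exists q.
have [pi' pi'P] := choice ex.
have pi'E q : P w q -> pi' (p q) = em_p (s w) (component w q).
  move=> wq; have [|q' [wq' q'q <-]] := pi'P (p q); first by exists q.
  exact: quotE.
exists (em_C (s w)), pi'; split; first exact: em_Psi.
split.
- move=> a c c' [q wq <-] [q' wq' <-]; rewrite -linearP !pi'E //.
    by rewrite !linearP.
  exact: carrier_lin.
- move=> y; have [q <-] := pp y; exists (p (dinj (Q := Q) q)).
    by exists (dinj (Q := Q) q).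
  by rewrite pi'E // component_dinj.
- move=> c [q wq <-]; rewrite pi'E //; split; first exact: quot_below.
  case=> [p0|[v vw [q' vq' q'E]]].
    by rewrite (quotE _ 0) ?raddf0 //; exact: carrier0.
  have wq' : P w q' by have [Pm _] := Pincr; apply: Pm vq'.
  by rewrite (quotE _ q') // vq' // raddf0.
- move=> c [->|[v vw [q vq <-]]]; first exact: carrier0.
  by exists q => //; have [Pm _] := Pincr; apply: Pm vq.
Qed.

End Cohorseshoe.

(** * Gorenstein projective modules *)

Section Gorenstein.
Variable R : nzRingType.
Implicit Types V X M G : lmodType R.

(** A single projective presentation decides the vanishing of Ext^1: any other
    extension of [G] is a pushout of it. *)
Lemma ext1_of_projective (K P G X : lmodType R)
    (i : {linear K -> P}) (p : {linear P -> G}) :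
  projective P -> short_exact i p ->
  (forall h : {linear K -> X}, exists k : {linear P -> X},
     forall x, k (i x) = h x) ->
  ext1_zero G X.
Proof.
move=> Pproj [i_inj ip ps] Kext N F j q [j_inj jq qs] h.
have [phi phiE] := Pproj _ _ q p qs.
have [|c cE] :=
    @factor_through_inj _ _ _ _ j (phi \o i : {linear _ -> _}) j_inj.
  by move=> x; apply/jq; rewrite /= phiE; apply/ip; exists x.
have [k kE] := Kext (h \o c : {linear _ -> _}).
(* [F] is the sum of the images of [phi] and [j]; the two prescriptions agree on
   their intersection, the image of [K]. *)
pose rel y z := exists x n, phi x + j n = y /\ k x + h n = z.
have [|||f fE] := @linear_choice R F X rel.
- move=> y; have [x xy] := ps (q y).
  have /jq[n nE] : q (y - phi x) = 0 by rewrite raddfB /= phiE xy subrr.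
  by exists (k x + h n), x, n; rewrite nE addrC subrK.
- move=> y z z' [x [n [<- <-]]] [x' [n' [xn' <-]]].
  have phiB : phi (x - x') = j (n' - n).
    rewrite !raddfB /=; apply/eqP.
    by rewrite subr_eq addrAC eq_sym subr_eq addrC xn'.
  have /ip[u uE] : p (x - x') = 0.
    by rewrite -phiE phiB; apply/jq; exists (n' - n).
  have cu : c u = n' - n by apply: j_inj; rewrite cE /= uE.
  have := kE u; rewrite /= uE cu !raddfB /= => /eqP.
  by rewrite subr_eq addrAC eq_sym subr_eq addrC => /eqP.
- move=> a y y' z z' [x [n [<- <-]]] [x' [n' [<- <-]]].
  exists (a *: x + x'), (a *: n + n'); rewrite !linearP !scalerDr.
  by split; rewrite addrACA.
exists f => n; have [x [m [jn <-]]] := fE (j n).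
have phiB : phi x = j (n - m) by rewrite raddfB /= -jn addrK.
have /ip[u uE] : p x = 0 by rewrite -phiE phiB; apply/jq; exists (n - m).
have cu : c u = n - m by apply: j_inj; rewrite cE /= uE.
by have := kE u; rewrite /= uE cu raddfB /= => ->; rewrite subrK.
Qed.

Section Splice.
Variables (A Z B Z' D Z'' : lmodType R).
Variables (p : {linear A -> Z}) (i : {linear Z -> B}) (p' : {linear B -> Z'})
  (i' : {linear Z' -> D}) (p'' : {linear D -> Z''}).
Hypotheses (ps : surj p) (ses : short_exact i p') (ses' : short_exact i' p'').

Lemma splice_exact :
  exact_at (i \o p : {linear _ -> _}) (i' \o p' : {linear _ -> _}).
Proof.
have [_ ip' _] := ses; have [i'_inj _ _] := ses'.
move=> b; split=> [/=|[a <-] /=]; last first.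
  by rewrite (ip' _).2 ?raddf0 //; exists (p a).
rewrite -[0](raddf0 i') => /i'_inj/ip'[z <-].
by have [a <-] := ps z; exists a.
Qed.

(** A map that kills the image of [A] factors through [Z'], and extends from
    [Z'] to [D] because Ext^1(Z'', X) = 0. *)
Lemma splice_hom_exact X : ext1_zero Z'' X ->
  Hom_exact_at X (i \o p : {linear _ -> _}) (i' \o p' : {linear _ -> _}).
Proof.
have [_ ip' p's] := ses.
move=> Xext h; split=> [hp|[k kE] a]; last first.
  by rewrite -kE /= (ip' _).2 ?raddf0 //; exists (p a).
have [|h' h'E] := @factor_through_surj _ _ _ _ p' h p's.
  by move=> b /ip'[z <-]; have [a <-] := ps z; apply: hp.
have [k kE] := Xext _ _ _ _ ses' h'.
by exists k => b /=; rewrite kE h'E.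
Qed.

End Splice.

(** One step of the resolution, to the left and to the right; the next module is
    kept with its proof of membership so that the step can be iterated. *)
Record left_step (Cl : lmodType R -> Prop) G := LeftStep {
  ls_K : {K : lmodType R | Cl K}; ls_F : lmodType R;
  ls_i : {linear sval ls_K -> ls_F}; ls_p : {linear ls_F -> G};
  ls_proj : projective ls_F; ls_ses : short_exact ls_i ls_p
}.

Record right_step (Cl : lmodType R -> Prop) G := RightStep {
  rs_C : {C : lmodType R | Cl C}; rs_F : lmodType R;
  rs_i : {linear G -> rs_F}; rs_p : {linear rs_F -> sval rs_C};
  rs_proj : projective rs_F; rs_ses : short_exact rs_i rs_p
}.

(** Splicing the short exact sequences obtained by iteration gives a complete
    resolution. The given module sits between [lo 0], the first projective into
    which it embeds, and [lo 1], the first projective that maps onto it. *)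
Lemma Gorenstein_of_class (XX Cl : lmodType R -> Prop) :
  (forall G, Cl G -> syzygy Cl G) -> (forall G, Cl G -> cosyzygy Cl G) ->
  (forall G X, Cl G -> XX X -> ext1_zero G X) ->
  forall G, Cl G -> Gorenstein_projective XX G.
Proof.
move=> Cl_syz Cl_cosyz Cl_ext G ClG.
pose T := {G : lmodType R | Cl G}.
have left_ex (H : T) : exists _ : left_step Cl (sval H), True.
  have [K [F [i [p [Fproj ses ClK]]]]] := Cl_syz _ (svalP H).
  by exists (@LeftStep Cl _ (exist _ K ClK) F i p Fproj ses).
have right_ex (H : T) : exists _ : right_step Cl (sval H), True.
  have [F [C [i [p [Fproj ses ClC]]]]] := Cl_cosyz _ (svalP H).
  by exists (@RightStep Cl _ (exist _ C ClC) F i p Fproj ses).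
pose lstep H := projT1 (cid (left_ex H)).
pose rstep H := projT1 (cid (right_ex H)).
pose G0 : T := exist _ G ClG.
pose Lo n : T := iter n (fun H => ls_K (lstep H)) G0.
pose Hi n : T := iter n (fun H => rs_C (rstep H)) G0.
pose L n := lstep (Lo n); pose U n := rstep (Hi n).
pose lo' n := if n is m.+1 then ls_F (L m) else rs_F (U 0%N).
pose hi' n := rs_F (U n.+1).
pose dlo' n : {linear lo' n.+1 -> lo' n} :=
  match n with
  | 0%N => rs_i (U 0%N) \o ls_p (L 0%N) : {linear _ -> _}
  | m.+1 => ls_i (L m) \o ls_p (L m.+1) : {linear _ -> _}
  end.
pose dmid' : {linear lo' 0%N -> hi' 0%N} :=
  rs_i (U 1%N) \o rs_p (U 0%N) : {linear _ -> _}.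
pose dhi' n : {linear hi' n -> hi' n.+1} :=
  rs_i (U n.+2) \o rs_p (U n.+1) : {linear _ -> _}.
have Lsurj n : surj (ls_p (L n)) by have [] := ls_ses (L n).
have Usurj n : surj (rs_p (U n)) by have [] := rs_ses (U n).
have [lses rses] := (fun n => ls_ses (L n), fun n => rs_ses (U n)).
exists (@BiSeq R lo' hi' dlo' dmid' dhi'); split.
- move=> n; split; last exact: rs_proj.
  by case: n => [|n]; [exact: rs_proj|exact: ls_proj].
- split=> [[|n]|||n].
  + exact: splice_exact (Lsurj 1%N) (lses 0%N) (rses 0%N).
  + exact: splice_exact (Lsurj n.+2) (lses n.+1) (lses n).
  + exact: splice_exact (Lsurj 0%N) (rses 0%N) (rses 1%N).
  + exact: splice_exact (Usurj 0%N) (rses 1%N) (rses 2%N).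
  + exact: splice_exact (Usurj n.+1) (rses n.+2) (rses n.+3).
- move=> X XXX; have Text (H : T) : ext1_zero (sval H) X.
    exact: Cl_ext (svalP H) XXX.
  split=> [[|n]|||n].
  + exact: splice_hom_exact (Lsurj 1%N) (lses 0%N) (rses 0%N) _ (Text _).
  + exact: splice_hom_exact (Lsurj n.+2) (lses n.+1) (lses n) _ (Text _).
  + exact: splice_hom_exact (Lsurj 0%N) (rses 0%N) (rses 1%N) _ (Text _).
  + exact: splice_hom_exact (Usurj 0%N) (rses 1%N) (rses 2%N) _ (Text _).
  + exact: splice_hom_exact (Usurj n.+1) (rses n.+2) (rses n.+3) _ (Text _).
- have [i_inj ip _] := rses 0%N; have [i'_inj _ _] := rses 1%N.
  exists (rs_i (U 0%N)); split=> // x /=; rewrite -(ip x); split=> [|->].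
    by move=> x0; apply: i'_inj; rewrite x0 raddf0.
  exact: raddf0.
Qed.

Definition cons_module (A : lmodType R) (B : nat -> lmodType R) n :
  lmodType R := if n is m.+1 then B m else A.

(** A complete resolution shifted by one place, so that the middle differential
    is the one to the right, respectively to the left, of the former one. *)
Section Shift.
Variable S : biseq R.

Definition shift_right : biseq R :=
  @BiSeq R (cons_module (hi S 0%N) (lo S)) (fun n => hi S n.+1)
    (fun n => match n return
         {linear lo S n -> cons_module (hi S 0%N) (lo S) n} with
       | 0%N => dmid S | m.+1 => dlo S m end)
    (dhi S 0%N) (fun n => dhi S n.+1).

Definition shift_left : biseq R :=
  @BiSeq R (fun n => lo S n.+1) (cons_module (lo S 0%N) (hi S))
    (fun n => dlo S n.+1) (dlo S 0%N)
    (fun n => match n return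
         {linear cons_module (lo S 0%N) (hi S) n -> hi S n} with
       | 0%N => dmid S | m.+1 => dhi S m end).

Lemma shift_right_every E : at_every_term E S -> at_every_term E shift_right.
Proof. by case=> h1 h2 h3 h4; split=> //=; case. Qed.

Lemma shift_left_every E : at_every_term E S -> at_every_term E shift_left.
Proof. by case=> h1 h2 h3 h4; split=> //=; case. Qed.

End Shift.

Variable XX : lmodType R -> Prop.
Local Notation GP := (Gorenstein_projective XX).

Lemma Gorenstein_cosyzygy G : GP G -> cosyzygy GP G.
Proof.
case=> S [Sproj Sex Shom [iota [iota_inj iotaP]]].
have [_ _ mid_ex hi_ex] := Sex.
have [|p pE] := @corestrict _ _ _ (ker_sub (dhi S 0%N)) (dmid S).
  by move=> x; apply/mid_ex; exists x.
exists (lo S 0%N), (sub_mod (ker_sub (dhi S 0%N))), iota, p; split.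
- by have [] := Sproj 0%N.
- split=> // [x|y].
    rewrite -iotaP -pE; split=> [->|]; first exact: raddf0.
    by move=> x0; apply: incl_inj; rewrite x0 raddf0.
  have /mid_ex[x xE] := inclP y.
  by exists x; apply: incl_inj; rewrite pE.
exists (shift_right S); split.
- move=> n; split; last by have [] := Sproj n.+1.
  by case: n => [|n]; [have [] := Sproj 0%N|have [] := Sproj n].
- exact: shift_right_every.
- by move=> X /Shom; apply: shift_right_every.
exists (incl _); split; first exact: incl_inj.
move=> x; split=> [kx|[g <-]]; last exact: (inclP g).
by exists (lift_sub (S := ker_sub (dhi S 0%N)) kx).
Qed.

Lemma Gorenstein_syzygy_ext G : GP G ->
  syzygy GP G /\ forall X, XX X -> ext1_zero G X.
Proof.
case=> S [Sproj Sex Shom [iota [iota_inj iotaP]]].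
have [lo_ex lo0_ex mid_ex hi_ex] := Sex.
have [|p pE] := @factor_through_inj R _ _ _ iota (dlo S 0%N) iota_inj.
  by move=> x; apply/iotaP/lo0_ex; exists x.
pose K := ker_sub (dlo S 0%N).
have ses : short_exact (incl K) p.
  split; first exact: incl_inj.
    move=> x; split=> [px|[k <-]]; last first.
      by apply: iota_inj; rewrite pE raddf0; exact: (inclP k).
    have kx : K x by rewrite /K /= -pE px raddf0.
    by exists (lift_sub kx).
  move=> g; have /lo0_ex[x xE] : dmid S (iota g) = 0 by apply/iotaP; exists g.
  by exists x; apply: iota_inj; rewrite pE.
have Fproj : projective (lo S 1%N) by have [] := Sproj 1%N.
split.
  exists (sub_mod K), (lo S 1%N), (incl K), p; split=> //.
  exists (shift_left S); split.
  - move=> n; split; first by have [] := Sproj n.+1.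
    by case: n => [|n]; [have [] := Sproj 0%N|have [] := Sproj n].
  - exact: shift_left_every.
  - by move=> X /Shom; apply: shift_left_every.
  exists (incl K); split; first exact: incl_inj.
  move=> x; split=> [kx|[g <-]]; last exact: (inclP g).
  by exists (lift_sub (S := K) kx).
move=> X XXX; apply: (ext1_of_projective Fproj ses) => h.
have [|q qE] := @corestrict _ _ _ K (dlo S 1%N).
  by move=> x; apply/lo_ex; exists x.
have [hom_ex _ _ _] := Shom X XXX.
have [|k kE] := (hom_ex 1%N (h \o q : {linear _ -> _})).1.
  move=> a /=; have -> : q (dlo S 2%N a) = 0; last exact: raddf0.
  by apply: incl_inj; rewrite qE raddf0; apply/lo_ex; exists a.
have {}hom_ex := hom_ex 0%N.
exists k => x; have /lo_ex[y yE] := inclP x.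
have -> : x = q y by apply: incl_inj; rewrite qE.
by rewrite qE kE.
Qed.

(** The complete resolution is not built by extending those of the factors but
    from the class of all filtered modules, which is stable under syzygies and
    cosyzygies. *)
Lemma Gorenstein_filtered G : (forall P, projective P -> XX P) ->
  filtered GP G -> GP G.
Proof.
move=> projXX; apply: (@Gorenstein_of_class XX (filtered GP)) => {G} G.
- move=> [W [lt [A [wo Afilt Afac]]]]; apply: filtered_syzygy.
  exists W, lt, A; split=> // w; have [H [pi [GPH sq]]] := Afac w.
  by exists H, pi; split=> //; have [] := Gorenstein_syzygy_ext GPH.
- apply: filtered_cosyzygy; first exact: Gorenstein_cosyzygy.
  by move=> H Q /Gorenstein_syzygy_ext[_ h] /projXX; apply: h.
move=> X [W [lt [A [wo Afilt Afac]]]] XXX; apply: eklof.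
exists W, lt, A; split=> // w; have [H [pi [GPH sq]]] := Afac w.
by exists H, pi; split=> //; have [_] := Gorenstein_syzygy_ext GPH; apply.
Qed.

End Gorenstein.

(** * Dimension shifting and reduction to cyclic modules *)

Section Dimension.
Variable R : nzRingType.
Implicit Types V X M G : lmodType R.
Implicit Types Phi Psi : lmodType R -> Prop.

(** An extension is a filtration in two steps. *)
Lemma filtered_extension Phi (G M K : lmodType R) (i : {linear G -> M})
    (p : {linear M -> K}) :
  short_exact i p -> Phi G -> Phi K -> filtered Phi M.
Proof.
move=> [i_inj ip ps] PhiG PhiK.
pose lt (u v : bool) : Prop := ~~ u && v.
have lt_wo : strict_well_order lt.
  split; last by case=> [] []; constructor.
    have acc0 : Acc lt false by apply: Acc_intro => v /andP[].
    case; last exact: acc0.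
    by apply: Acc_intro; case=> [/andP[] | _]; [by []|exact: acc0].
  by move=> [] [] [].
exists bool, lt, (fun b => if b then full_sub M else im_sub i (full_sub G)).
split=> //.
  split; first by split=> [[] []//|[] x -> //]; exact: carrier0.
  by move=> x; right; exists true.
case.
  exists K, p; split=> //; split=> //.
  - by move=> a x y _ _; rewrite linearP.
  - by move=> y; have [x <-] := ps y; exists x.
  - move=> x _; rewrite ip; split=> [[a <-]|[->|[[]// _ [a _ <-]]]].
    + by right; exists false => //; exists a.
    + by exists 0; rewrite raddf0.
    + by exists a.
have ex x : exists g, im_sub i (full_sub G) x -> i g = x.
  by have [[g _ <-]|n] := EM (im_sub i (full_sub G) x); [exists g|exists 0].
have [f fP] := choice ex.
have fi g : f (i g) = g by apply: i_inj; rewrite fP //; exists g.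
exists G, f; split=> //; split.
- by move=> a _ _ [x _ <-] [y _ <-]; rewrite -linearP !fi.
- by move=> g; exists (i g) => //; exists g.
- move=> _ [g _ <-]; rewrite fi; split=> [->|[ig0|[[]//]]].
    by left; exact: raddf0.
  by apply: i_inj; rewrite ig0 raddf0.
- by move=> x [->|[[]//]]; exact: carrier0.
Qed.

(** For a well-order of the elements of [M], let stage [w] be the span of the
    [v <= w]. It is the sum of the earlier stages and of the multiples of [w],
    so its factor is [R / I] for the ideal [I] of those [r] such that [r *: w]
    already lies in an earlier stage. *)
Lemma filtered_cyclic Phi M :
  (forall I : submodClosed (R^o : lmodType R), Phi (quot_mod I)) ->
  filtered Phi M.
Proof.
move=> Phi_cyc; have [lt lt_wo] := exists_strict_well_order M.
pose A (w : M) := span_sub (fun v => v = w \/ lt v w).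
have Aw w : A w w by move=> S; apply; left.
have [_ lt_trans _] := lt_wo.
have Aincr : increasing lt (zero_sub M) A.
  split=> [v w x vw Ax S Sw|w x ->]; last exact: carrier0.
  by apply: Ax => u [->|uv]; apply: Sw; right => //; apply: lt_trans uv vw.
exists M, lt, A; split=> //; first by split=> // x; right; exists x.
move=> w; pose B := union_sub lt_wo Aincr (lt^~ w).
have [c cE] : exists c : {linear (R^o : lmodType R) -> M},
    forall r, c r = (r : R) *: w.
  by apply: linear_of => b x y; rewrite scalerDl scalerA.
pose I : submodClosed (R^o : lmodType R) :=
  GRing.SubmodClosed.clone R (R^o : lmodType R) (in_sub (preim_sub c B)) _.
have IE r s : quot_proj I r = quot_proj I s <-> B (c r - c s).
  by rewrite quot_projP -raddfB; split=> /asboolP.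
have decomp x : A w x -> exists r, B (x - c r).
  move=> /(_ (sum_im_sub c B)); apply=> v [->|vw].
    by exists 1; rewrite cE scale1r subrr; exact: carrier0.
  by exists 0; rewrite raddf0 subr0; right; exists v.
have ex x : exists q, A w x -> exists2 r, B (x - c r) & q = quot_proj I r.
  have [/decomp[r xr]|n] := EM (A w x); last by exists 0.
  by exists (quot_proj I r) => _; exists r.
have [f fP] := choice ex.
have BA x (Bx : B x) : A w x := below_sub Aincr Bx.
have fE x r : A w x -> B (x - c r) -> f x = quot_proj I r.
  move=> /fP[s xs ->] xr; apply/IE.
  by have := carrierB xr xs; rewrite opprB addrC addrA subrK.
exists (quot_mod I), f; split=> //; split=> //.
- move=> a x y Ax Ay; have [[r xr ->] [s ys ->]] := (fP x Ax, fP y Ay).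
  rewrite -linearP; apply: fE; first exact: carrier_lin.
  by rewrite linearP opprD addrACA -scalerBr; exact: (carrier_lin a xr ys).
- move=> q; have Ac : A w (c (quot_repr q)) by rewrite cE; apply: carrierZ.
  exists (c (quot_repr q)) => //.
  by rewrite (fE _ (quot_repr q)) ?quot_reprK // subrr; exact: carrier0.
- move=> x Ax; have [r xr ->] := fP x Ax.
  rewrite -(raddf0 (quot_proj I)) IE raddf0 subr0.
  split=> [rB|xB].
    by rewrite -[x](subrK (c r)); exact: (carrierD (S := B) xr rB).
  by rewrite -[c r](subKr x); exact: (carrierB (S := B) xB xr).
Qed.

Lemma syzygy_mono Phi Psi G :
  (forall H, Phi H -> Psi H) -> syzygy Phi G -> syzygy Psi G.
Proof.
by move=> PhiPsi [K [F [i [p [h1 h2 /PhiPsi h3]]]]]; exists K, F, i, p.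
Qed.

Lemma iter_syzygy_mono n Phi Psi G :
  (forall H, Phi H -> Psi H) ->
  iter n (@syzygy R) Phi G -> iter n (@syzygy R) Psi G.
Proof.
move=> PhiPsi; elim: n G => [|n IH] G /=; first exact: PhiPsi.
exact: syzygy_mono.
Qed.

Lemma iter_syzygy_le m n Phi G :
  (forall H, Phi H -> syzygy Phi H) -> (m <= n)%N ->
  iter m (@syzygy R) Phi G -> iter n (@syzygy R) Phi G.
Proof.
move=> Phi_syz /subnK <-; elim: (n - m)%N => //= k IH /IH {IH}.
rewrite -iterS iterSr; exact: iter_syzygy_mono.
Qed.

Lemma iter_syzygy_filtered n Phi M : (forall H, filtered Phi H -> Phi H) ->
  filtered (iter n (@syzygy R) Phi) M -> iter n (@syzygy R) Phi M.
Proof.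
move=> PhiF; elim: n M => [|n IH] M /=; first exact: PhiF.
by move/filtered_syzygy; apply: syzygy_mono.
Qed.

Lemma sub_mod_zero M (x : sub_mod (zero_sub M)) : x = 0.
Proof. by apply: incl_inj; rewrite raddf0; exact: (inclP x). Qed.

Lemma zero_projective M : projective (sub_mod (zero_sub M)).
Proof.
move=> A B f g fs; exists (\0 : {linear _ -> _}) => x.
by rewrite (sub_mod_zero x) !raddf0.
Qed.

(** A projective [P] is its own resolution on both sides: 0 -> P -> P and
    P -> P -> 0. *)
Lemma projective_Gorenstein (XX : lmodType R -> Prop) (P : lmodType R) :
  projective P -> Gorenstein_projective XX P.
Proof.
have ses (Q : lmodType R) :
    short_exact (incl (zero_sub Q)) (idfun : {linear Q -> Q}).
  split; [exact: incl_inj| |by move=> x; exists x].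
  move=> x; split=> [/= ->|[z <-]]; last exact: (inclP z).
  by exists 0.
apply: (@Gorenstein_of_class R XX (@projective R)).
- move=> {}P Pproj; exists (sub_mod (zero_sub P)), P, (incl _), idfun.
  by split=> //; [exact: ses|exact: zero_projective].
- move=> {}P Pproj; exists P, (sub_mod (zero_sub P)), idfun.
  exists (\0 : {linear _ -> _}); split=> //; last exact: zero_projective.
  split=> // [x|y]; first by split=> // _; exists x.
  by exists 0; rewrite (sub_mod_zero y).
- move=> {}P X Pproj _; apply: ext1_of_projective Pproj (ses P) _ => h.
  by exists (\0 : {linear _ -> _}) => x; rewrite (sub_mod_zero x) !raddf0.
Qed.

Section Gorenstein.
Variable XX : lmodType R -> Prop.
Hypothesis projXX : forall P, projective P -> XX P.
Local Notation GP := (Gorenstein_projective XX).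
Local Notation syzygies n := (iter n (@syzygy R) GP).

Lemma Gorenstein_iso G M (f : {linear M -> G}) :
  injective f -> surj f -> GP G -> GP M.
Proof.
move=> f_inj fs [S [h1 h2 h3 [iota [iota_inj iotaP]]]]; exists S; split=> //.
exists (iota \o f : {linear _ -> _}); split; first exact: inj_comp.
move=> x; rewrite iotaP; split=> [[g <-]|[m <-]]; last by exists (f m).
by have [m <-] := fs g; exists m.
Qed.

Lemma syzygies_resolution n M : syzygies n M -> Gorenstein_resolution XX n M.
Proof.
elim: n M => [|n IH] M /=.
  move=> GM; pose Z := sub_mod (zero_sub M).
  have Z0 (x : Z) : x = 0 by exact: sub_mod_zero.
  pose G := cons_module M (fun=> Z).
  exists G, (fun i => \0 : {linear G i.+1 -> G i}).
  exists (idfun : {linear M -> M}); split.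
  - by case.
  - by case=> // i _ x; exact: Z0.
  - by move=> x; exists x.
  - by move=> b; split=> [/= ->|[a <-]//]; exists 0.
  - by move=> i b; split=> // _; exists 0; rewrite (Z0 b).
case=> [K [F [i [p [Fproj [i_inj ip ps] /IH[G [d [e [GG G0 es ede dd]]]]]]]]].
exists (cons_module F G).
exists (fun j => match j return {linear G j -> cons_module F G j} with
  0%N => i \o e : {linear _ -> _} | k.+1 => d k end).
exists (p : {linear cons_module F G 0%N -> M}); split=> //.
- by case=> [_|j]; [exact: projective_Gorenstein|exact: GG].
- by case=> // j; apply: G0.
- move=> b; rewrite ip; split=> [[k <-]|[a <-]]; last by exists (e a).
  by have [a <-] := es k; exists a.
- case=> [|j]; last exact: dd.
  move=> b; rewrite -ede; split=> [/= ieb|/= ->]; last exact: raddf0.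
  by apply: i_inj; rewrite ieb raddf0.
Qed.

(** Resolutions by Gorenstein projectives can be taken projective except in the
    last place. With [M = G_0 / K] and [G_0 = P / G'], where [P] is projective
    and [G'] Gorenstein projective, the kernel of [P -> M] is an extension of
    [K] by [G']. By induction [K] lies in [syzygies n], and so does [G'] because
    syzygies of Gorenstein projectives can be chosen Gorenstein projective;
    [syzygies n] is closed under extensions. *)
Lemma resolution_syzygies n M : Gorenstein_resolution XX n M -> syzygies n M.
Proof.
have GPsyz G : GP G -> syzygy GP G by case/Gorenstein_syzygy_ext.
elim: n M => [|n IH] M [G [d [e [GG G0 es ede dd]]]].
  have e_inj : injective e.
    move=> x y xy; apply/eqP; rewrite -subr_eq0; apply/eqP.
    have /ede[a <-] : e (x - y) = 0 by rewrite raddfB /= xy subrr.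
    by rewrite (G0 1%N isT a) raddf0.
  have [|f fE] :=
      @factor_through_inj R M (G 0%N) M e (idfun : {linear M -> M}) e_inj.
    by move=> x; have [y <-] := es x; exists y.
  apply: (Gorenstein_iso (f := f)); last exact: GG.
    by move=> x y xy; rewrite -[x](fE x) -[y](fE y) /= xy.
  by move=> y; exists (e y); apply: e_inj; rewrite fE.
pose K := sub_mod (ker_sub e).
have [|e' e'E] := @corestrict _ _ _ (ker_sub e) (d 0%N).
  by move=> x; apply/ede; exists x.
have KP : syzygies n K.
  apply: IH; exists (fun i => G i.+1), (fun i => d i.+1), e'; split.
  - by move=> i; exact: (GG i.+1).
  - by move=> i; exact: (G0 i.+1).
  - move=> k; have /ede[a aE] := inclP k.
    by exists a; apply: incl_inj; rewrite e'E.
  - move=> b; rewrite -dd -e'E; split=> [->|b0]; first exact: raddf0.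
    by apply: incl_inj; rewrite b0 raddf0.
  - by move=> i; apply: dd.
have [G' [P [i [p [Pproj ses G'P]]]]] := GPsyz _ (GG 0%N isT).
have [i_inj ip ps] := ses.
pose q : {linear P -> M} := e \o p : {linear _ -> _}.
have qs : surj q.
  by move=> m; have [g <-] := es m; have [x <-] := ps g; exists x.
exists (sub_mod (ker_sub q)), P, (incl (ker_sub q)), q; split=> //.
  exact: kernel_exact.
have [|j jE] := @corestrict _ _ _ (ker_sub q) i.
  by move=> x; rewrite /= (ip _).2 ?raddf0 //; exists x.
have [|r rE] := @corestrict _ _ _ (ker_sub e)
    (p \o incl (ker_sub q) : {linear _ -> _}).
  by move=> x; exact: (inclP x).
apply: iter_syzygy_filtered => [H|]; first exact: Gorenstein_filtered.
apply: (filtered_extension (i := j) (p := r)) => //; last first.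
  exact: (iter_syzygy_le (m := 0)).
split.
- by move=> x y xy; apply: i_inj; rewrite -!jE xy.
- move=> x; split=> [rx|[g <-]].
    have /ip[g gE] : p (incl _ x) = 0 by have := rE x; rewrite rx raddf0.
    by exists g; apply: incl_inj; rewrite jE.
  apply: incl_inj; rewrite rE raddf0.
    by apply/ip; exists g; rewrite -jE.
- move=> k; have [x xE] := ps (incl _ k).
  have kx : ker_sub q x by rewrite /= xE; exact: (inclP k).
  by exists (lift_sub kx); apply: incl_inj; rewrite rE.
Qed.

Lemma syzygies_of_cyclic n :
  (forall I : submodClosed (R^o : lmodType R), syzygies n (quot_mod I)) ->
  forall M, syzygies n M.
Proof.
move=> cyc M; apply: iter_syzygy_filtered; last exact: filtered_cyclic.
by move=> H; exact: Gorenstein_filtered.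
Qed.

Local Open Scope classical_set_scope.
Local Open Scope ereal_scope.
Variable K : realType.

Lemma Gpd_le_syzygies n M : Gpd K XX M <= n%:R%:E <-> syzygies n M.
Proof.
split=> [Mn|/syzygies_resolution Mn]; last by apply: ereal_inf_lbound; exists n.
suff [m mn Mm] : exists2 m, (m <= n)%N & Gorenstein_resolution XX m M.
  apply: iter_syzygy_le mn _; last exact: resolution_syzygies.
  by move=> G /Gorenstein_syzygy_ext[].
apply: contrapT => noRes; move: Mn; apply/negP; rewrite -ltNge.
apply: (@lt_le_trans _ _ n.+1%:R%:E); first by rewrite lte_fin ltr_nat.
apply: le_ereal_inf_tmp => _ [m Mm ->]; rewrite lee_fin ler_nat ltnNge.
by apply/negP => mn; apply: noRes; exists m.
Qed.

End Gorenstein.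

(** * Comparison of dimensions *)

Local Open Scope classical_set_scope.
Local Open Scope ereal_scope.

Definition natural_or_oo (K : realType) (x : \bar K) : Prop :=
  x = +oo \/ exists n : nat, x = n%:R%:E.

Lemma bounded_least (K : realType) (x : \bar K) : x < +oo ->
  exists2 n : nat, x <= n%:R%:E & forall m, x <= m%:R%:E -> (n <= m)%N.
Proof.
move=> xoo; have [n xn] : exists n : nat, x <= n%:R%:E.
  move: xoo; case: x => [r _|//|_]; last by exists 0%N; rewrite leNye.
  exists (Num.bound `|r|%R); rewrite lee_fin ltW //.
  by rewrite (le_lt_trans (ler_norm r)) ?archi_boundP.
have ex : exists n : nat, `[< x <= n%:R%:E >] by exists n; apply/asboolP.
exists (ex_minn ex); case: ex_minnP => m /asboolP // _ mmin k xk.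
by apply: mmin; apply/asboolP.
Qed.

(** A bounded set of natural numbers attains its supremum. *)
Lemma sup_natural (K : realType) (A : set \bar K) :
  A !=set0 -> (forall x, A x -> natural_or_oo x) -> natural_or_oo (ereal_sup A).
Proof.
move=> [a Aa] Anat; have [->|nsup] := eqVneq (ereal_sup A) +oo; first by left.
have [|[|n] supn nmin] := @bounded_least K (ereal_sup A); first by rewrite ltey.
  right; exists 0%N; apply/eqP; rewrite eq_le supn /=.
  apply: le_trans (ereal_sup_ubound Aa).
  by have [->|[m ->]] := Anat a Aa; rewrite ?leey // lee_fin.
right; exists n.+1; apply/eqP; rewrite eq_le supn /=.
rewrite leNgt; apply/negP => supn1.
suff /nmin : ereal_sup A <= n%:R%:E by rewrite ltnn.
apply: ge_ereal_sup => x Ax.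
have := le_lt_trans (ereal_sup_ubound Ax) supn1.
have [->|[m ->]] := Anat x Ax; first by rewrite ltNge leey.
by rewrite lte_fin ltr_nat lee_fin ler_nat.
Qed.

Lemma Gpd_natural (K : realType) XX M : natural_or_oo (Gpd K XX M).
Proof.
have [->|nsup] := eqVneq (Gpd K XX M) +oo; first by left.
have [|n Mn nmin] := @bounded_least K (Gpd K XX M); first by rewrite ltey.
right; exists n; apply/eqP; rewrite eq_le Mn /=.
apply: le_ereal_inf_tmp => _ [m Mm ->]; rewrite lee_fin ler_nat; apply: nmin.
by apply: ereal_inf_lbound; exists m.
Qed.

Lemma le_of_natural_bounds (K : realType) (x y : \bar K) : natural_or_oo y ->
  (forall n : nat, y <= n%:R%:E -> x <= n%:R%:E) -> x <= y.
Proof. by case=> [->|[n ->]] h; [exact: leey|exact: h]. Qed.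

Lemma quot_mod_finitely_generated (I : submodClosed (R^o : lmodType R)) :
  finitely_generated (quot_mod I).
Proof.
exists 1%N, (fun=> quot_proj I 1) => m; exists (fun=> quot_repr m).
rewrite big_ord1 -linearZ /= -[LHS]quot_reprK; congr (quot_proj _ _).
by rewrite /GRing.scale /= mulr1.
Qed.

End Dimension.

(** * Reduction of the global dimension to finitely generated modules *)

Local Open Scope classical_set_scope.
Local Open Scope ring_scope.
Local Open Scope ereal_scope.

Theorem theorem4p4 (K : realType) (R : nzRingType) (XX : lmodType R -> Prop)
    (hXX : forall P : lmodType R, projective P -> XX P) :
  (forall n : nat,
     [<-> Ggldim K XX <= n%:R%:E;
          forall M : lmodType R, finitely_generated M ->
            Gpd K XX M <= n%:R%:E;
          forall I : submodClosed R^o, Gpd K XX (quot_mod I) <= n%:R%:E]) /\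
  Ggldim K XX =
    ereal_sup [set d | exists2 M : lmodType R,
                         finitely_generated M & d = Gpd K XX M] /\
  Ggldim K XX =
    ereal_sup [set d | exists I : submodClosed R^o, d = Gpd K XX (quot_mod I)].
Proof.
have bound n :
    (forall I : submodClosed R^o, Gpd K XX (quot_mod I) <= n%:R%:E) ->
    Ggldim K XX <= n%:R%:E.
  move=> cyc; apply: ge_ereal_sup => _ [M ->]; apply/Gpd_le_syzygies => //.
  by apply: syzygies_of_cyclic => // I; apply/(Gpd_le_syzygies hXX K).
have Gpd_le M : Gpd K XX M <= Ggldim K XX.
  by apply: ereal_sup_ubound; exists M.
have fg := @quot_mod_finitely_generated R.
(* Some left ideal, so that the sets of dimensions are not empty. *)
pose I0 : submodClosed R^o :=
  GRing.SubmodClosed.clone R R^o (in_sub (zero_sub R^o)) _.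
split=> [n|].
  tfae=> [le_n M _|fg_le I|]; first exact: le_trans (Gpd_le M) le_n.
    exact: fg_le (fg I).
  exact: bound.
split; apply/eqP; rewrite eq_le; apply/andP; split.
- apply: le_of_natural_bounds => [|n sup_n].
    apply: sup_natural => [|_ [M _ ->]]; last exact: Gpd_natural.
    by exists (Gpd K XX (quot_mod I0)), (quot_mod I0).
  apply: bound => I; apply: le_trans sup_n.
  by apply: ereal_sup_ubound; exists (quot_mod I).
- by apply: ge_ereal_sup => _ [M _ ->].
- apply: le_of_natural_bounds => [|n sup_n].
    apply: sup_natural => [|_ [I ->]]; last exact: Gpd_natural.
    by exists (Gpd K XX (quot_mod I0)), I0.
  apply: bound => I; apply: le_trans sup_n.
  by apply: ereal_sup_ubound; exists I.
- by apply: ge_ereal_sup => _ [I ->].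
Qed.
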